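(* Let $K\ge2$ and suppose $\phi:[0,1]\times\mathbb R^K\to\mathbb R$ is a classical solution of $$0\ \ge\ \partial_t\phi(t,x)+\frac12\sup_{i\in[K],\,a\in\mathcal P(\{0,1\}^K)}\mathrm{Tr}\Big(D^2_{xx}\phi(t,x)\sum_{j\subset[K]}a(j)\big(\mathbf 1_{i\in j}e_{j^c}e_{j^c}^\top+\mathbf 1_{i\notin j}e_je_j^\top\big)\Big),\quad (t,x)\in[0,1)\times\mathbb R^K,$$ $$\phi(1,x)\ge\max_i x^i,\qquad \phi(t,x+\lambda\mathbf 1)=\phi(t,x)+\lambda,$$ and that for some positive constant $C$, for all $(t,x)\in[0,1)\times\mathbb R^K$, $$|\partial^2_{tt}\phi(t,x)|\le\frac{C}{(1-t)^{3/2}},\qquad |\partial^3_{xxx}\phi(t,x)|+|\partial^2_{tx}\phi(t,x)|\le\frac{C}{1-t}.$$ Let $m_0$ be the initial belief. For each horizon $T$, let $\beta^*=(\beta^*_0,\dots,\beta^*_{T-1})$ be the strategy of the forecaster which at round $n$, when the current belief is $m$, plays $$\beta^*_n(m)=D_m\Phi\big(t_n,\widetilde m,[\widetilde m]\big)=\int D_x\phi(t_n,x)\,\widetilde m(dx),\qquad t_n=\tfrac nT,\quad \widetilde m=m^{*\frac1{\sqrt T}},$$ where $\Phi(t,m)=\int\phi(t,x)\,m(dx)$. Then $\beta^*$ yields regret bounded above by $\sqrt T\int\phi(0,x)\,\widetilde m_0(dx)$ asymptotically, where $\widetilde m_0=m_0^{*1/\sqrt T}$; that is, $$\limsup_{T\to\infty}\left(\frac1{\sqrt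 T}\sup_{\alpha\in\mathcal A}\gamma_T(0,m_0,\alpha,\beta^{*})-\int\phi(0,x)\,\widetilde m_0(dx)\right)\le0 .$$
   Context: Notation: $[K]=\{1,\dots,K\}$; $\mathcal P(E)$: probability measures on $E$; elements of $\{0,1\}^K$ are identified with subsets $j\subset[K]$, $j^c=[K]\setminus j$; $e_1,\dots,e_K$ canonical basis of $\mathbb R^K$, $e_j=\sum_{i\in j}e_i$, $e=\mathbf 1=\sum_{i=1}^Ke_i$; $\lambda$ ranges over $\mathbb R$. Elements of $\mathcal P([K])$ are identified with vectors of $\mathbb R^K$. For a finite measure $\mu$: $\int f\,d\mu_{\sharp v}=\int f(x+v)\mu(dx)$, $\int f\,d\mu^{*\lambda}=\int f(\lambda x)\mu(dx)$. $D_m\Phi(t,m,x)$ is the Wasserstein derivative of $\Phi(t,\cdot)$ (the $x$-gradient of its linear functional derivative), which for this $\Phi$ equals $D_x\phi(t,x)$, and $D_m\Phi(t,m,[m'])=\int D_m\Phi(t,m,x)\,m'(dx)$. Game with horizon $T$: $X_0\sim m_0\in\mathcal P(\mathbb R^K)$. At rounds $n=0,\dots,T-1$ the forecaster picks $b_n\in\mathcal P([K])$ and, independently, the adversary picks $a_n\in\mathcal P(\{0,1\}^K)$; $I_n\sim b_n$, $J_n\sim a_n$ are drawn independently; $X_{n+1}=X_n+e_{J_n}-\mathbf 1_{\{I_n\in J_n\}}e$; the signal is $Y_n=I_n$ if $I_n\in J_n$, $Y_n=-I_n$ otherwise. Before round $n$ both players know $h_n=(m_0,a_0,y_0,\dots,a_{n-1},y_{n-1})$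 (the state is not observed). Strategies are sequences of measurable maps $h_n\mapsto\alpha_n(h_n)\in\mathcal P(\{0,1\}^K)$ (adversary, set $\mathcal A$) and $h_n\mapsto\beta_n(h_n)\in\mathcal P([K])$ (forecaster, set $\mathcal B$). The regret is $\gamma_T(0,m_0,\alpha,\beta)=\mathbb E^{m_0,\alpha,\beta}[\max_iX_T^i]$. Belief: $m_n$ is the conditional law of $X_n$ given $h_n$, computed by $m_{n+1}=l(m_n,a_n,y_n)$, where, with $\hat a(i)=\sum_{j:i\in j}a(j)$ and $\hat a(-i)=\sum_{j:i\notin j}a(j)$, $$l(m,a,i)=\sum_{j:i\in j}\Big(\tfrac{a(j)}{\hat a(i)}m\Big)_{\sharp -e_{j^c}},\qquad l(m,a,-i)=\sum_{j:i\notin j}\Big(\tfrac{a(j)}{\hat a(-i)}m\Big)_{\sharp e_j},$$ and $l(m,a,y)=\delta_{\mathbf 0}$ if $\hat a(y)=0$. *)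

(* Defs.v *)
From HB Require Import structures.
From mathcomp Require Import all_boot all_order all_algebra.
From mathcomp Require Import all_classical all_reals all_analysis.

Set Implicit Arguments.
Unset Strict Implicit.
Unset Printing Implicit Defensive.

Import Order.TTheory GRing.Theory Num.Theory.
Import numFieldNormedType.Exports.

Local Open Scope classical_set_scope.
Local Open Scope ring_scope.

Record fdist (R : realType) (F : finType) := FDist {
  fdist_fun :> F -> R ;
  fdist_ge0 : forall i, 0 <= fdist_fun i ;
  fdist_sum1 : \sum_i fdist_fun i = 1 }.

Notation state R K := (g_sigma_algebraType (@open 'rV[R]_K)).

Section state_space.
Variables (R : realType) (K : nat).

Definition ind (j : {set 'I_K}) : 'rV[R]_K := \row_i (i \in j)%:R.

(* The maximum of the coordinates, meaningful for 0 < K: the supremum of a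
   nonempty finite set of reals. *)
Definition maxcoord (x : 'rV[R]_K) : R := sup (range (x ord0)).

Definition translate (v : 'rV[R]_K) (x : state R K) : state R K := x + v.

Definition dilate (c : R) (x : state R K) : state R K := c *: x.

Lemma continuous_borel_measurable (f : 'rV[R]_K -> 'rV[R]_K) :
  continuous f -> measurable_fun setT (f : state R K -> state R K).
Proof.
move=> /continuousP cf.
apply: (@measurability _ _ (state R K) (state R K) setT f (@open 'rV[R]_K)) => //.
by move=> _ [B oB <-]; rewrite setTI; apply: sub_sigma_algebra; exact: cf.
Qed.

Lemma measurable_translate v : measurable_fun setT (translate v).
Proof.
apply: continuous_borel_measurable => x.
have : {for x, continuous ((fun y : 'rV[R]_K => y) + cst v)}.
  by apply: continuousD; [exact: cvg_id|exact: cst_continuous].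
exact.
Qed.

Lemma measurable_dilate c : measurable_fun setT (dilate c).
Proof.
apply: continuous_borel_measurable => x.
exact: (@scaler_continuous R 'rV[R]_K c).
Qed.

HB.instance Definition _ v :=
  @isMeasurableFun.Build _ _ _ _ (translate v) (measurable_translate v).
HB.instance Definition _ c :=
  @isMeasurableFun.Build _ _ _ _ (dilate c) (measurable_dilate c).

End state_space.

Arguments ind {R K} j.

Section game.
Variables (R : realType) (K : nat).

(* The signal i is (i, true), the signal -i is (i, false). *)
Definition signal := ('I_K * bool)%type.

Definition signal_of (i : 'I_K) (j : {set 'I_K}) : signal := (i, i \in j).

Definition increment (i : 'I_K) (j : {set 'I_K}) : 'rV[R]_K :=
  ind j - (i \in j)%:R *: const_mx 1.

(* The pair (a_n, y_n). *)
Definition round := (fdist R {set 'I_K} * signal)%type.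

(* The sigma-algebra of the histories ((a_0, y_0), ..., (a_{n-1}, y_{n-1})):
   Borel in each a_k, seen as a vector indexed by the subsets of [K], and
   discrete in each y_k. *)
Definition history_measurable (n : nat) : set (set (n.-tuple round)) :=
  <<s [set E | exists k : 'I_n,
         (exists j : {set 'I_K}, exists2 B : set (measurableTypeR R),
            measurable B & E = [set h : n.-tuple round | B ((tnth h k).1 j)])
         \/ (exists y : signal, E = [set h : n.-tuple round | (tnth h k).2 = y])] >>.

(* A strategy maps a history of any length n to the mixed action of round n;
   the initial belief is fixed and left out of the histories. *)
Definition is_strategy (F : finType) (s : seq round -> fdist R F) : Prop :=
  forall (n : nat) (f : F) (B : set (measurableTypeR R)), measurable B ->
    history_measurable [set h : n.-tuple round | B (s h f)].

Definition adversary := seq round -> fdist R {set 'I_K}.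
Definition forecaster := seq round -> fdist R 'I_K.

(* The history produced by a sequence of drawn pairs (I_n, J_n). *)
Definition history (alpha : adversary) (w : seq ('I_K * {set 'I_K})) :
    seq round :=
  foldl (fun h ij => rcons h (alpha h, signal_of ij.1 ij.2)) [::] w.

(* The probability that (I_n, J_n)_(n < T) = w; it does not depend on X_0. *)
Definition path_prob (T : nat) (alpha : adversary) (beta : forecaster)
    (w : T.-tuple ('I_K * {set 'I_K})) : R :=
  \prod_(n < T) (beta (history alpha (take n w)) (tnth w n).1
                  * alpha (history alpha (take n w)) (tnth w n).2).

Definition final_state (T : nat) (x : 'rV[R]_K)
    (w : T.-tuple ('I_K * {set 'I_K})) : 'rV[R]_K :=
  x + \sum_(n < T) increment (tnth w n).1 (tnth w n).2.

(* The law of (X_0, (I_n, J_n)_n) is the product of m0 and path_prob. The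
   expectation may be infinite when m0 has no first moment. *)
Definition regret (T : nat) (m0 : probability (state R K) R)
    (alpha : adversary) (beta : forecaster) : \bar R :=
  (\int[m0]_x (\sum_(w : T.-tuple ('I_K * {set 'I_K}))
                 path_prob alpha beta w * maxcoord (final_state x w))%:E)%E.

End game.

Section belief.
Variables (R : realType) (K : nat).
Local Notation E := (state R K).

Definition compatible (y : signal K) (j : {set 'I_K}) : bool :=
  (y.1 \in j) == y.2.

Definition signal_prob (a : fdist R {set 'I_K}) (y : signal K) : R :=
  \sum_(j | compatible y j) a j.

Definition shift_of (y : signal K) (j : {set 'I_K}) : 'rV[R]_K :=
  if y.2 then - ind (~: j) else ind j.

Section posterior.
Variables (m : probability E R) (a : fdist R {set 'I_K}) (y : signal K).

Definition posterior (A : set E) : \bar R :=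
  if signal_prob a y == 0 then \d_(0 : E) A
  else (\sum_(j | compatible y j)
          (a j / signal_prob a y)%:E
          * distribution m (translate (shift_of y j)) A)%E.

Lemma signal_prob_ge0 : 0 <= signal_prob a y.
Proof. by apply: sumr_ge0 => j _; exact: fdist_ge0. Qed.

Let weight_ge0 j : 0 <= a j / signal_prob a y.
Proof. by rewrite divr_ge0 ?signal_prob_ge0 ?fdist_ge0. Qed.

Let posterior0 : posterior set0 = 0%E.
Proof.
rewrite /posterior; case: ifPn => _; first exact: measure0.
by rewrite big1// => j _; rewrite measure0 mule0.
Qed.

Let posterior_ge0 A : (0 <= posterior A)%E.
Proof.
rewrite /posterior; case: ifPn => _; first exact: measure_ge0.
by apply: sume_ge0 => j _; rewrite mule_ge0// lee_fin.
Qed.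

Let posterior_sigma_additive : semi_sigma_additive posterior.
Proof.
move=> F mF tF mUF; rewrite /posterior; case: ifPn => _.
  exact: measure_semi_sigma_additive.
pose mu j : {measure set E -> \bar R} :=
  mscale (NngNum (weight_ge0 j)) (distribution m (translate (shift_of y j))).
rewrite [X in _ --> X](_ : _ = limn (fun n => \sum_(0 <= i < n)
    \sum_(j | compatible y j) mu j (F i))%E); last first.
  rewrite nneseries_sum//; apply: eq_bigr => j _.
  exact: (measure_semi_bigcup (mu j)).
apply: is_cvg_ereal_nneg_natsum => k _; apply: sume_ge0 => j _.
exact: (measure_ge0 (mu j)).
Qed.

HB.instance Definition _ := isMeasure.Build _ _ _ posterior
  posterior0 posterior_ge0 posterior_sigma_additive.

Let posterior_setT : posterior setT = 1%E.
Proof.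
rewrite /posterior; case: ifPn => [_|p0]; first exact: probability_setT.
under eq_bigr do rewrite probability_setT mule1.
by rewrite sumEFin -mulr_suml divff.
Qed.

HB.instance Definition _ := Measure_isProbability.Build _ _ _ posterior
  posterior_setT.

End posterior.

Definition belief (m0 : probability E R) (h : seq (round R K)) :
    probability E R :=
  foldl (fun m r => posterior m r.1 r.2 : probability E R) m0 h.

End belief.

Section calculus.
Variables (R : realType) (K : nat).
Implicit Types (f : R -> 'rV[R]_K -> R) (t : R) (x : 'rV[R]_K).

(* The time variable lives in [0, 1]: the derivative is one-sided at t = 0,
   and the values of f outside [0, 1] are irrelevant. *)
Definition time_quotient f t x (s : R) : R := (s - t)^-1 * (f s x - f t x).
Definition time_derivable f t x : Prop :=
  cvg (time_quotient f t x @ within `[0, 1] t^').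
Definition dt f t x : R :=
  lim (time_quotient f t x @ within `[0, 1] t^').

Definition unit_vec (i : 'I_K) : 'rV[R]_K := delta_mx ord0 i.

Definition space_derivable (i : 'I_K) f t x : Prop :=
  derivable (f t) x (unit_vec i).
Definition dx (i : 'I_K) f t x : R := 'D_(unit_vec i) (f t) x.

Definition hessian f t x : 'M[R]_K := \matrix_(i, j) dx i (dx j f) t x.

Definition strip : set (R * 'rV[R]_K) := [set p | 0 <= p.1 < 1].
Definition closed_strip : set (R * 'rV[R]_K) := [set p | 0 <= p.1 <= 1].

Definition continuous_on (D : set (R * 'rV[R]_K)) f : Prop :=
  {within D, continuous (fun p => f p.1 p.2)}.

(* Regularity of a classical solution: f is continuous on [0, 1] x R^K and of
   class C^{1,2} on [0, 1) x R^K. *)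
Definition classical f : Prop :=
  [/\ continuous_on closed_strip f,
      (forall t x, 0 <= t < 1 -> time_derivable f t x)
        /\ continuous_on strip (dt f),
      (forall i t x, 0 <= t < 1 -> space_derivable i f t x)
        /\ (forall i, continuous_on strip (dx i f)) &
      (forall i j t x, 0 <= t < 1 -> space_derivable i (dx j f) t x)
        /\ (forall i j, continuous_on strip (dx i (dx j f)))].

Definition higher_derivable f t x : Prop :=
  [/\ time_derivable (dt f) t x,
      (forall i, space_derivable i (dt f) t x) &
      (forall i j k, space_derivable i (dx j (dx k f)) t x)].

(* Euclidean (Frobenius) norms. *)
Definition norm_dtx f t x : R := Num.sqrt (\sum_i dx i (dt f) t x ^+ 2).

Definition norm_dxxx f t x : R :=
  Num.sqrt (\sum_i \sum_j \sum_k dx i (dx j (dx k f)) t x ^+ 2).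

(* sum_j a(j) (1_{i in j} e_{j^c} e_{j^c}^T + 1_{i notin j} e_j e_j^T);
   vectors are rows here, so v v^T reads v^T *m v. *)
Definition diffusion (i : 'I_K) (a : fdist R {set 'I_K}) : 'M[R]_K :=
  \sum_(j : {set 'I_K})
    a j *: (if i \in j then (ind (~: j))^T *m ind (~: j)
            else (ind j)^T *m ind j).

(* sup_(i, a) Tr(D^2_xx f(t, x) * diffusion i a): the supremum of a bounded set
   of reals, nonempty when 0 < K. *)
Definition generator f t x : R :=
  sup [set \tr (hessian f t x *m diffusion i a) | i in [set: 'I_K]
       & a in [set: fdist R {set 'I_K}]].

Definition Phi f t (m : probability (state R K) R) : \bar R :=
  (\int[m]_x (f t x)%:E)%E.

(* The i-th coordinate of D_m Phi(t, m, [m]); the Wasserstein derivative of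
   m |-> Phi(t, m), which is linear in m, is D_x f(t, x). *)
Definition DmPhi f t (m : probability (state R K) R) (i : 'I_K) : \bar R :=
  (\int[m]_x (dx i f t x)%:E)%E.

Definition rescale (c : R) (m : probability (state R K) R) :
    probability (state R K) R := distribution m (@dilate R K c).

End calculus.

(* Main.v *)
(* Along any play, Taylor expansion of [phi (t_n, X_n / sqrt T)] over one round
   has a first-order term of zero mean, because the forecaster plays the mean
   gradient under the belief, and second-order and time terms that add up to
   something nonpositive by the PDE inequality, pointwise in the state.  With [k]
   rounds to go the remainder is [O (1 / (k sqrt T))]; in time this comes from
   comparing with [- 4 C sqrt (1 - t)], which also covers the last round, where
   the derivatives blow up.  The remainders sum to [O (log T / sqrt T)].  Since
   [phi] is nonincreasing in time it dominates [max_i x_i], which gives the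
   integrability of all terms once [phi (0, .)] and [max_i x_i] are integrable;
   otherwise the regret is [-oo] or the bound is [+oo]. *)

Require Import Defs.
From mathcomp Require Import all_boot all_order all_algebra.
From mathcomp Require Import all_classical all_reals all_analysis.
From mathcomp Require Import measurable_realfun ring lra.

Set Implicit Arguments.
Unset Strict Implicit.
Unset Printing Implicit Defensive.

Import Order.TTheory GRing.Theory Num.Theory.
Import numFieldNormedType.Exports.

Local Open Scope classical_set_scope.
Local Open Scope ring_scope.

(** * Taylor bounds in one and several variables *)

(** The state is hidden, so the cancellation of the first-order term is available only after
    integration against the belief, whereas the PDE and the Taylor remainders act at each state. The
    induction therefore compares integrals under the current belief, and it passes to the next round
    by conditioning on the signal: weighted by the signal probabilities, the posteriors reassemble
    the law of the moved state. The rate comes from the scaling [c = 1 / sqrt T]: with [k] rounds to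
    go [1 - t = k c ^ 2], so a cubic term [c ^ 3 / (1 - t)] is [c / k]. The logarithm of the
    harmonic sum is replaced by the cruder [4 T ^ (1/4)], which still vanishes after division by
    [sqrt T]. The third derivatives and the second time derivative are only known to exist and to be
    bounded at each time, so every expansion rests on mean value arguments rather than on integral
    remainders. *)

(** The mean value theorem for [u], then for [u1], which decreases. Derivatives are asked only
    inside the interval, and continuity of [u1] only up to the left end: this accommodates the
    one-sided time derivative at 0 and the blow-up at time 1. *)
Lemma concave_le_tangent (R : realType) (u u1 u2 : R -> R) (a b : R) :
  a < b ->
  {within `[a, b], continuous u} ->
  (forall x, x \in `]a, b[%R -> is_derive x 1 u (u1 x)) ->
  {within `[a, b[, continuous u1} ->
  (forall x, x \in `]a, b[%R -> is_derive x 1 u1 (u2 x)) ->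
  (forall x, x \in `]a, b[%R -> u2 x <= 0) ->
  u b <= u a + (b - a) * u1 a.
Proof.
move=> ab cu du cu1 du1 u2_le0.
have [c cab uE] := MVT ab du cu.
have [ac cb] : a < c /\ c < b by move: cab; rewrite in_itv => /andP[].
have sub x : x \in `]a, c[%R -> x \in `]a, b[%R.
  by rewrite !in_itv/= => /andP[-> /lt_trans ->].
have cu1' : {within `[a, c], continuous u1}.
  apply: continuous_subspaceW cu1 => x /=; rewrite !in_itv/= => /andP[-> xc].
  exact: le_lt_trans cb.
have [d dac u1E] := MVT ac (fun x xac => du1 x (sub x xac)) cu1'.
have u1_le : u1 c <= u1 a.
  by rewrite -subr_le0 u1E mulr_le0_ge0 ?u2_le0 ?sub// subr_ge0 ltW.
by rewrite -lerBlDl uE mulrC ler_wpM2l// subr_ge0 ltW.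
Qed.

Section directional_derivatives.
Variables (R : realType) (V : normedModType R).
Implicit Types (f : V -> R) (x y v w : V).

Lemma is_derive_line f y v (s d : R) :
  is_derive (y + s *: v) v f d -> is_derive s 1 (fun r => f (y + r *: v)) d.
Proof.
move=> [fd fE].
have quotE : (fun h : R => h^-1 *: (((fun r => f (y + r *: v)) \o shift s) (h *: 1)
    - f (y + s *: v)))
  = (fun h : R => h^-1 *: ((f \o shift (y + s *: v)) (h *: v) - f (y + s *: v))).
  apply/funext => h /=; congr (_ *: (f _ - _)).
  by rewrite [h *: 1]mulr1 scalerDl addrCA.
by apply: DeriveDef; rewrite /derivable /derive quotE.
Qed.

Lemma mvt_line f y v (s : R) : (forall x, derivable f x v) ->
  exists2 r, `|r| <= `|s| & f (y + s *: v) - f y = s * 'D_v f (y + r *: v).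
Proof.
move=> fd.
have dline (z : R) : is_derive z 1 (fun r : R => f (y + r *: v)) ('D_v f (y + z *: v)).
  by apply: is_derive_line; exact: derivableP.
have cline (A : set R) : {within A, continuous (fun r : R => f (y + r *: v))}.
  apply: continuous_subspaceT => z; apply: differentiable_continuous.
  exact/derivable1_diffP/ex_derive.
have [s0|s0|<-] := ltgtP 0 s.
- have [r] := MVT s0 (fun z _ => dline z) (cline _).
  rewrite in_itv/= => /andP[r0 rs]; rewrite subr0 scale0r addr0 => ->.
  exists r; last by rewrite mulrC.
  by rewrite !gtr0_norm// ltW.
- have [r] := MVT s0 (fun z _ => dline z) (cline _).
  rewrite in_itv/= => /andP[rs r0]; rewrite sub0r scale0r addr0 => E; exists r.
    by rewrite !ltr0_norm// lerN2 ltW.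
  by rewrite -opprB E mulrN opprK mulrC.
- by exists 0; rewrite ?normr0// scale0r addr0 subrr mul0r.
Qed.

(** Inductive step from continuous partial derivatives to all directional derivatives: the quotient
    along [w + a *: v] splits at [h *: w + x], and by the mean value theorem the second piece is [a]
    times a derivative along [v] at a nearby point. *)
Lemma is_deriveD_dir f x v w (a d : R) :
  (forall y, derivable f y v) -> {for x, continuous ('D_v f)} ->
  is_derive x w f d -> is_derive x (w + a *: v) f (d + a * 'D_v f x).
Proof.
move=> fv cv [fw fE].
have rcvg : h^-1 * (f (h *: w + x + (h * a) *: v) - f (h *: w + x))
    @[h --> (0 : R)^'] --> a * 'D_v f x.
  apply/cvgrPdist_le => e e0.
  have a1 : 0 < `|a| + 1 by rewrite ltr_wpDl.
  have /cvgrPdist_le /(_ (e / (`|a| + 1))) := cv.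
  rewrite divr_gt0// => /(_ isT) /nbhs_normP[r /= r0 near_x].
  have M0 : 0 < `|w| + `|a| * `|v| + 1.
    by rewrite ltr_wpDl// addr_ge0// mulr_ge0.
  near=> h.
  have h0 : h != 0 by near: h; exact: nbhs_dnbhs_neq.
  have [s sle ->] := mvt_line (h *: w + x) (h * a) fv.
  rewrite mulrA mulKf// -mulrBr normrM.
  have hr : `|h| < r / (`|w| + `|a| * `|v| + 1).
    by near: h; apply: dnbhs0_lt; rewrite divr_gt0.
  have : `|'D_v f x - 'D_v f (h *: w + x + s *: v)| <= e / (`|a| + 1).
    apply: near_x; rewrite /ball_ /=.
    rewrite -addrA addrCA opprD addNKr normrN.
    apply: (le_lt_trans (ler_normD _ _)); rewrite !normrZ.
    rewrite ltr_pdivlMr// in hr; apply: le_lt_trans hr.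
    rewrite !mulrDr -addrA lerD2l mulrA.
    apply: (@le_trans _ _ (`|h| * `|a| * `|v|)).
      by rewrite ler_wpM2r// -normrM.
    by rewrite lerDl mulr1.
  move=> De; apply: (@le_trans _ _ (`|a| * (e / (`|a| + 1)))).
    by rewrite ler_wpM2l.
  by rewrite mulrCA ger_pMr// ler_pdivrMr// mul1r lerDl.
have wcvg : h^-1 * (f (h *: w + x) - f x) @[h --> (0 : R)^'] --> d.
  by rewrite -fE; exact: fw.
have sumE : (fun h : R => h^-1 *: ((f \o shift x) (h *: (w + a *: v)) - f x))
  = (fun h => h^-1 * (f (h *: w + x) - f x)
     + h^-1 * (f (h *: w + x + (h * a) *: v) - f (h *: w + x))).
  apply/funext => h /=.
  rewrite -mulrDr [X in _ = _ * X]addrC addrA subrK /=; congr (_ * (f _ - _)).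
  by rewrite scalerDr scalerA addrAC.
have cvg_tot := cvgD wcvg rcvg.
apply: DeriveDef.
  by rewrite /derivable sumE; apply/cvg_ex; eexists; exact: cvg_tot.
by rewrite /derive sumE; apply/cvg_lim => //; exact: cvg_tot.
Unshelve. all: by end_near. Qed.

End directional_derivatives.

Section row_vectors.
Variables (R : realType) (K : nat).
Implicit Types (f : 'rV[R]_K -> R) (x y v : 'rV[R]_K).
Local Notation e i := (unit_vec R i).

Lemma row_unit_vec v : v = \sum_i v ord0 i *: e i.
Proof. exact: row_sum_delta. Qed.

Lemma is_derive_row f x v :
  (forall i y, derivable f y (e i)) ->
  (forall i, {for x, continuous ('D_(e i) f)}) ->
  is_derive x v f (\sum_i v ord0 i * 'D_(e i) f x).
Proof.
move=> fd fc; rewrite {1}(row_unit_vec v).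
pose P (w : 'rV[R]_K) (d : R) := is_derive x w f d.
suff : forall s, P (\sum_(i <- s) v ord0 i *: e i)
                   (\sum_(i <- s) v ord0 i * 'D_(e i) f x) by exact.
elim=> [|i s IH]; first by rewrite !big_nil; exact: is_derive0.
rewrite !big_cons /P [X in is_derive _ X]addrC [X in is_derive _ _ _ X]addrC.
exact: is_deriveD_dir.
Qed.

Lemma is_derive_row_line f y v (s : R) :
  (forall i y, derivable f y (e i)) ->
  (forall i, continuous ('D_(e i) f)) ->
  is_derive s 1 (fun r => f (y + r *: v))
    (\sum_i v ord0 i * 'D_(e i) f (y + s *: v)).
Proof.
by move=> fd fc; apply: is_derive_line; apply: is_derive_row => // i; exact: fc.
Qed.

(** One coordinate at a time, by the mean value theorem. Bounded partial derivatives suffice, which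
    is all that is known of those of the Hessian entries and of [dt phi]. *)
Lemma lipschitz_row f x v (M : R) :
  (forall i y, derivable f y (e i)) ->
  (forall i y, `|'D_(e i) f y| <= M) ->
  `|f (x + v) - f x| <= M * \sum_i `|v ord0 i|.
Proof.
move=> fd fM; rewrite {1}(row_unit_vec v).
elim: (index_enum _) => [|i s IH].
  by rewrite !big_nil addr0 subrr normr0 mulr0.
rewrite !big_cons [v ord0 i *: _ + _]addrC addrA mulrDr.
set y := x + _ in IH *.
have [r _ rE] := mvt_line y (v ord0 i) (fd i).
rewrite (_ : f _ - f x = (f (y + v ord0 i *: e i) - f y) + (f y - f x)); last first.
  by rewrite [RHS]addrA subrK.
apply: (le_trans (ler_normD _ _)); apply: lerD => //.
by rewrite rE normrM mulrC ler_wpM2r.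
Qed.

(** The remainder is measured by the oscillation [M] of the second derivatives along the segment,
    which [lipschitz_row] can supply without continuous third derivatives. *)
Lemma taylor2_row f x v (M : R) :
  (forall i y, derivable f y (e i)) ->
  (forall i, continuous ('D_(e i) f)) ->
  (forall i j y, derivable ('D_(e j) f) y (e i)) ->
  (forall i j, continuous ('D_(e i) ('D_(e j) f))) ->
  (forall i j s, 0 <= s <= 1 ->
    `|'D_(e i) ('D_(e j) f) (x + s *: v) - 'D_(e i) ('D_(e j) f) x| <= M) ->
  f (x + v) <= f x + \sum_i v ord0 i * 'D_(e i) f x
    + 2^-1 * (\sum_j \sum_i v ord0 j * v ord0 i * 'D_(e i) ('D_(e j) f) x)
    + 2^-1 * (M * (\sum_i `|v ord0 i|) ^+ 2).
Proof.
move=> fd fc f2d f2c f2M.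
pose g1 (s : R) := \sum_j v ord0 j * 'D_(e j) f (x + s *: v).
pose g2 (s : R) := \sum_j v ord0 j * \sum_i v ord0 i * 'D_(e i) ('D_(e j) f) (x + s *: v).
(* [L] bounds the second derivative along the segment, so subtracting [L / 2 * s ^+ 2] makes the
   function concave. *)
pose L := g2 0 + M * (\sum_i `|v ord0 i|) ^+ 2.
have dg (s : R) : is_derive s 1 (fun s => f (x + s *: v)) (g1 s).
  exact: is_derive_row_line.
have dg1 (s : R) : is_derive s 1 g1 (g2 s).
  have -> : g1 = \sum_j (fun s => v ord0 j * 'D_(e j) f (x + s *: v)).
    by apply/funext => r; rewrite fct_sumE.
  apply: is_derive_sum => j.
  exact: (is_deriveZ (v ord0 j) (is_derive_row_line x v s (f2d^~ j) (f2c^~ j))).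
pose u (s : R) := f (x + s *: v) - L / 2 * s ^+ 2.
pose u1 (s : R) := g1 s - L * s.
have du (s : R) : is_derive s 1 u (u1 s).
  have dsq := is_deriveZ (L / 2) (is_deriveX 2 (is_derive_id s (1 : R))).
  apply: (is_derive_eq (is_deriveB (dg s) dsq)).
  by rewrite /u1 /GRing.scale/= expr1; field.
have du1 (s : R) : is_derive s 1 u1 (g2 s - L).
  apply: (is_derive_eq (is_deriveB (dg1 s) (is_deriveZ L (is_derive_id s (1 : R))))).
  by rewrite /GRing.scale/= mulr1.
have ct (h h' : R -> R) (A : set R) : (forall s : R, is_derive s 1 h (h' s)) ->
    {within A, continuous h}.
  move=> dh; apply: continuous_subspaceT => s.
  exact/differentiable_continuous/derivable1_diffP/ex_derive.
have := @concave_le_tangent R u u1 (fun s => g2 s - L) 0 1 ltr01 (ct _ _ _ du)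
  (fun s _ => du s) (ct _ _ _ du1) (fun s _ => du1 s).
have g2L s : s \in `]0, 1[%R -> g2 s - L <= 0.
  rewrite in_itv/= => /andP[s0 s1]; rewrite /L opprD addrA subr_le0.
  apply: (le_trans (ler_norm _)); rewrite /g2 -sumrB.
  apply: (le_trans (ler_norm_sum _ _ _)).
  rewrite expr2 mulr_suml mulr_sumr; apply: ler_sum => j _.
  rewrite -mulrBr normrM mulrCA ler_wpM2l// -sumrB.
  apply: (le_trans (ler_norm_sum _ _ _)).
  rewrite mulr_sumr; apply: ler_sum => i _.
  rewrite -mulrBr normrM mulrC ler_wpM2r// scale0r addr0.
  by apply: f2M; rewrite !ltW.
move=> /(_ g2L); rewrite /u /u1 /L /g1 /g2 !scale0r !scale1r !addr0.
have -> : \sum_j \sum_i v ord0 j * v ord0 i * 'D_(e i) ('D_(e j) f) x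
        = \sum_j v ord0 j * \sum_i v ord0 i * 'D_(e i) ('D_(e j) f) x.
  by apply: eq_bigr => j _; rewrite mulr_sumr; apply: eq_bigr => i _; rewrite mulrA.
move=> H; lra.
Qed.

End row_vectors.

(** * Separate regularity in time and in space *)

Section regularity.
Variables (R : realType) (K : nat).
Implicit Types (g : R -> 'rV[R]_K -> R) (D : set (R * 'rV[R]_K)).

Lemma continuous_on_comp (X : topologicalType) D g (A : set X)
    (h : X -> R * 'rV[R]_K) :
  continuous_on D g -> continuous h -> (forall x, A x -> D (h x)) ->
  {within A, continuous (fun x => g (h x).1 (h x).2)}.
Proof.
move=> /subspace_continuousP cg ch AD; apply/subspace_continuousP => x Ax.
have := cg _ (AD _ Ax); apply: cvg_trans => U gU.
have hU : nbhs x (fun y => D (h y) -> U (g (h y).1 (h y).2)) := ch x _ gU.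
suff : nbhs x (fun y => A y -> U (g (h y).1 (h y).2)) by [].
by apply: filterS hU => y hU /AD.
Qed.

Lemma continuous_pair_cst (X Y : topologicalType) (a : X) :
  continuous (fun y : Y => (a, y)).
Proof.
move=> y; apply: (@cvg_pair _ _ _ _ (nbhs a) (nbhs y)).
  exact: cvg_cst.
exact: cvg_id.
Qed.

Lemma continuous_on_time D g z (A : set R) :
  continuous_on D g -> (forall s, A s -> D (s, z)) ->
  {within A, continuous (g^~ z)}.
Proof.
move=> cg AD; have := @continuous_on_comp R D g A (fun s => (s, z)) cg.
apply=> // s; exact: (cvg_pair (@cvg_id _ _) (cvg_cst z)).
Qed.

Lemma continuous_on_space D g t :
  continuous_on D g -> (forall x, D (t, x)) -> continuous (g t).
Proof.
move=> cg AD.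
apply/continuous_subspace_setT.
exact: (continuous_on_comp cg (@continuous_pair_cst _ 'rV[R]_K t) (fun x _ => AD x)).
Qed.

(** Strictly inside [0, 1] small increments never leave the interval, so the limit defining [dt] is
    two-sided. *)
Lemma is_derive_time g t x : 0 < t < 1 -> time_derivable g t x ->
  is_derive t 1 (g^~ x) (dt g t x).
Proof.
move=> /andP[t0 t1] gt.
have shiftE : (fun h : R => h^-1 *: (((g^~ x) \o shift t) (h *: 1) - g t x))
    @ (0 : R)^' --> dt g t x.
  apply: cvg_trans gt => U /=; rewrite /within/= !near_simpl /= => -[r /= r0 rU].
  have m0 : 0 < Num.min r (Num.min t (1 - t)).
    by rewrite !lt_min r0 t0 subr_gt0.
  near=> h.
  have hm : `|h| < Num.min r (Num.min t (1 - t)) by near: h; exact: dnbhs0_lt.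
  have h0 : h != 0 by near: h; exact: nbhs_dnbhs_neq.
  move: hm; rewrite !lt_min => /and3P[hr ht h1].
  have /(_ _ _ _) := rU (h + t); rewrite /time_quotient addrK [h *: 1]mulr1.
  apply.
  - by rewrite /ball_ /= opprD addrCA subrr addr0 normrN.
  - by rewrite -subr_eq0 addrK.
  - rewrite in_itv/=; move: ht h1; rewrite !ltr_norml => /andP[? ?] /andP[? ?].
    by apply/andP; split; lra.
apply: DeriveDef; first by apply/cvg_ex; eexists; exact: shiftE.
exact/cvg_lim.
Unshelve. all: by end_near. Qed.

End regularity.

Section time_bound.
Variables (R : realType) (C : R).

Lemma powR_3half (x : R) : 0 <= x -> x `^ (3 / 2) = x * Num.sqrt x.
Proof.
move=> x0; rewrite (_ : 3 / 2 = 1 + 2^-1); last by field.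
rewrite powRD ?powRr1// ?powR12_sqrt//; apply/implyP => /eqP; lra.
Qed.

(* [- 4 C sqrt (1 - s)] has second derivative [C / (1 - s)^(3/2)]. *)
Lemma sqrt_time_bound (u u1 u2 : R -> R) (a b : R) :
  a < b -> b <= 1 ->
  {within `[a, b], continuous u} ->
  (forall s, s \in `]a, b[%R -> is_derive s 1 u (u1 s)) ->
  {within `[a, b[, continuous u1} ->
  (forall s, s \in `]a, b[%R -> is_derive s 1 u1 (u2 s)) ->
  (forall s, s \in `]a, b[%R -> u2 s <= C / (1 - s) `^ (3 / 2)) ->
  u b <= u a + (b - a) * u1 a
    + (4 * C * (Num.sqrt (1 - a) - Num.sqrt (1 - b))
       - (b - a) * (2 * C / Num.sqrt (1 - a))).
Proof.
move=> ab b1 cu du cu1 du1 u2C.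
pose q (s : R) := Num.sqrt (1 - s).
have cq : continuous q.
  move=> s; apply: continuous_comp; last exact: sqrt_continuous.
  by apply: cvgB; [exact: cvg_cst|exact: cvg_id].
have q_gt0 s : s < b -> 0 < q s by move=> sb; rewrite sqrtr_gt0 subr_gt0 (lt_le_trans sb).
have dq (s : R) : s < b -> is_derive s 1 q (- (2 * q s)^-1).
  move=> sb; have s1 : 0 < 1 - s by rewrite subr_gt0 (lt_le_trans sb).
  have d1 : is_derive s 1 (fun s : R => 1 - s) (-1).
    apply: (is_derive_eq
      (is_deriveB (is_derive_cst (1 : R) s 1) (is_derive_id s (1 : R)))).
    by rewrite sub0r.
  have := @is_derive1_comp _ Num.sqrt (fun s : R => 1 - s) s _ _
    (is_derive1_sqrt s1) d1.
  by move=> H; apply: (is_derive_eq H); rewrite mulrN1.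
have c_u : {within `[a, b], continuous (fun s => u s + 4 * C * q s)}.
  apply/subspace_continuousP => s sab; apply: cvgD.
    by move/subspace_continuousP : cu; exact.
  apply: cvgM; first exact: cvg_cst.
  by apply: cvg_within_filter; exact: cq.
have c_u1 : {within `[a, b[, continuous (fun s => u1 s - 2 * C * (q s)^-1)}.
  apply/subspace_continuousP => s sab; apply: cvgB.
    by move/subspace_continuousP : cu1; exact.
  apply: cvgM; first exact: cvg_cst.
  apply: cvgV; last by apply: cvg_within_filter; exact: cq.
  by rewrite gt_eqF// q_gt0//; move: sab; rewrite /= in_itv/= => /andP[].
have d_u s : s \in `]a, b[%R ->
    is_derive s 1 (fun s => u s + 4 * C * q s) (u1 s - 2 * C * (q s)^-1).
  move=> sab; have sb : s < b by move: sab; rewrite in_itv/= => /andP[].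
  apply: (is_derive_eq (is_deriveD (du s sab) (is_deriveZ (4 * C) (dq s sb)))).
  by rewrite /GRing.scale/=; field; rewrite gt_eqF ?q_gt0.
have d_u1 s : s \in `]a, b[%R -> is_derive s 1 (fun s => u1 s - 2 * C * (q s)^-1)
    (u2 s - C / (1 - s) `^ (3 / 2)).
  move=> sab; have sb : s < b by move: sab; rewrite in_itv/= => /andP[].
  have qs0 : q s != 0 by rewrite gt_eqF ?q_gt0.
  have s1 : 0 <= 1 - s by rewrite subr_ge0 ltW// (lt_le_trans sb).
  apply: (is_derive_eq (is_deriveB (du1 s sab)
    (is_deriveZ (2 * C) (is_deriveV qs0 (dq s sb))))).
  rewrite powR_3half// -[X in C / (X * _)](sqr_sqrtr s1) -/(q s) /GRing.scale/=.
  by field.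
have := concave_le_tangent ab c_u d_u c_u1 d_u1.
have u2_le s : s \in `]a, b[%R -> u2 s - C / (1 - s) `^ (3 / 2) <= 0.
  by move=> sab; rewrite subr_le0 u2C.
by move=> /(_ u2_le); rewrite /q; lra.
Qed.

End time_bound.

(** * Integrals against the posterior beliefs *)

Section maxcoord.
Variables (R : realType) (K : nat).
Hypothesis K_gt0 : (0 < K)%N.
Implicit Types x v : 'rV[R]_K.

Lemma le_maxcoord x i : x ord0 i <= maxcoord x.
Proof.
apply: ub_le_sup; last by exists i.
exists (\sum_i `|x ord0 i|) => _ [k _ <-]; rewrite (bigD1 k)//=.
by apply: (le_trans (ler_norm _)); rewrite lerDl sumr_ge0.
Qed.

Lemma maxcoord_le x (M : R) : (forall i, x ord0 i <= M) -> maxcoord x <= M.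
Proof.
move=> xM; apply: ge_sup => [|_ [i _ <-]//].
by exists (x ord0 (Ordinal K_gt0)); exists (Ordinal K_gt0).
Qed.

Lemma maxcoordZ (c : R) x : 0 < c -> maxcoord (c *: x) = c * maxcoord x.
Proof.
move=> c0; apply/eqP; rewrite eq_le; apply/andP; split.
  by apply: maxcoord_le => i; rewrite mxE ler_wpM2l ?le_maxcoord// ltW.
rewrite mulrC -ler_pdivlMr//; apply: maxcoord_le => i.
by rewrite ler_pdivlMr// mulrC; have := le_maxcoord (c *: x) i; rewrite mxE.
Qed.

Lemma maxcoord_lipschitz x v (r : R) : (forall i, `|v ord0 i| <= r) ->
  `|maxcoord (x + v) - maxcoord x| <= r.
Proof.
move=> vr; rewrite ler_norml; apply/andP; split.
  rewrite lerBrDr addrC lerBlDr; apply: maxcoord_le => i.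
  rewrite -lerBlDr; apply: le_trans (le_maxcoord _ i); rewrite mxE lerD2l lerNl.
  by apply: le_trans (vr i); rewrite -normrN ler_norm.
rewrite lerBlDr addrC; apply: maxcoord_le => i; rewrite mxE lerD ?le_maxcoord//.
by apply: le_trans (vr i); rewrite ler_norm.
Qed.

Lemma continuous_maxcoord : continuous (@maxcoord R K).
Proof.
move=> /= x U /= /(nbhs_ballP (maxcoord x)) [e /= e0 eU].
apply/nbhs_ballP; exists (e / 2) => /=; first by rewrite divr_gt0.
move=> y [_ xy]; apply: eU; rewrite /ball/= distrC.
rewrite (_ : y = x + (y - x)); last by rewrite addrC subrK.
apply: (@le_lt_trans _ _ (e / 2)); last by rewrite ltr_pdivrMr// ltr_pMr// ltr1n.
apply: maxcoord_lipschitz => i; rewrite !mxE distrC.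
by apply: ltW; exact: (xy ord0 i).
Qed.

End maxcoord.

Section integration.
Variables (R : realType) (K : nat).
Local Notation E := (state R K).
Implicit Types (m : probability E R) (f g : E -> R).

Lemma continuous_row_measurable f :
  continuous (f : 'rV[R]_K -> R) -> measurable_fun setT f.
Proof.
move=> /continuousP cf.
apply: (@measurability _ _ E _ setT f _ (RGenOpens.measurableE R)).
move=> _ [_ [a [b ->] <-]]; rewrite setTI; apply: sub_sigma_algebra.
exact/cf/interval_open.
Qed.

Lemma measurable_maxcoord : (0 < K)%N ->
  measurable_fun setT (@maxcoord R K : E -> R).
Proof.
by move=> K0; apply: continuous_row_measurable; exact: continuous_maxcoord.
Qed.

Lemma measurable_comp_dilate f c : measurable_fun setT f ->
  measurable_fun setT (fun x : E => f (c *: x)).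
Proof.
by move=> mf; apply: (measurableT_comp mf); exact: (@measurable_dilate R K c).
Qed.

(** The change of variables is made separately on the positive and negative parts, so it can be
    applied before finiteness is known. *)
Lemma integral_distribution_EFin m (X : {mfun E >-> E}) f : measurable_fun setT f ->
  (\int[distribution m X]_y (f y)%:E = \int[m]_x (f (X x))%:E)%E.
Proof.
move=> mf; pose g : E -> \bar R := fun y => (f y)%:E.
have mg : measurable_fun setT g by exact/measurable_EFinP.
rewrite integralE [RHS]integralE -[fun x => (f (X x))%:E]/(g \o X).
rewrite (funepos_comp g X) (funeneg_comp g X); congr (_ - _)%E.
- exact: (ge0_integral_distribution X (measurable_funepos mg) (funepos_ge0 g)).
- exact: (ge0_integral_distribution X (measurable_funeneg mg) (funeneg_ge0 g)).
Qed.

Lemma measurable_comp_translate f (v : 'rV[R]_K) : measurable_fun setT f ->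
  measurable_fun setT (fun x : E => f (translate v x)).
Proof. by move=> mf; apply: measurableT_comp => //; exact: measurable_translate. Qed.

Section posterior_integral.
Variables (m : probability E R) (a : fdist R {set 'I_K}) (y : signal K).
Hypothesis p_neq0 : signal_prob a y != 0.
Local Notation w j := (a j / signal_prob a y).
Local Notation tr j := (translate (shift_of R y j)).

Lemma posterior_weight_ge0 j : 0 <= w j.
Proof. by rewrite divr_ge0 ?signal_prob_ge0 ?fdist_ge0. Qed.

Lemma ge0_integral_posterior f : measurable_fun setT f -> (forall x, 0 <= f x) ->
  (\int[posterior m a y]_x (f x)%:E =
   \sum_(j | compatible y j) (w j)%:E * \int[m]_x (f (tr j x))%:E)%E.
Proof.
move=> mf f0; have mf' : measurable_fun setT (fun x : E => (f x)%:E) by exact/measurable_EFinP.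
(* [msum] is indexed by natural numbers, so the compatible subsets are listed; in the sum the
   default of [nth] is never reached. *)
pose s := enum (compatible y).
pose mu n : {measure set E -> \bar R} :=
  mscale (NngNum (posterior_weight_ge0 (nth finset.set0 s n)))
    (distribution m (tr (nth finset.set0 s n))).
have sumE (F : {set 'I_K} -> \bar R) :
    (\sum_(n < size s) F (nth finset.set0 s n) = \sum_(j | compatible y j) F j)%E.
  rewrite -(big_mkord xpredT (fun n => F (nth finset.set0 s n))).
  by rewrite -(big_nth _ xpredT) big_enum.
rewrite (@eq_measure_integral _ _ _ setT (msum mu (size s))); last first.
  move=> A mA _; rewrite /= /posterior (negbTE p_neq0) /msum/=.
  by rewrite -(sumE (fun j => (w j)%:E * distribution m (tr j) A)%E).
rewrite ge0_integral_measure_sum//; last by move=> x _; rewrite lee_fin.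
rewrite -(sumE (fun j => (w j)%:E * \int[m]_x (f (tr j x))%:E)%E).
apply: eq_bigr => n _; rewrite ge0_integral_mscale//; last by move=> x _; rewrite lee_fin.
by rewrite integral_distribution_EFin.
Qed.

(** Only subsets that are played need an integrable translate: the others enter with weight 0, and
    [0 * +oo = 0]. *)
Lemma integrable_posterior f : measurable_fun setT f ->
  (forall j, compatible y j -> a j != 0 ->
    m.-integrable setT (EFin \o (fun x => f (tr j x)))) ->
  (posterior m a y).-integrable setT (EFin \o f).
Proof.
move=> mf fi; apply/integrableP; split; first exact/measurable_EFinP.
have mnf : measurable_fun setT (fun x => `|f x|) by exact: measurableT_comp.
rewrite (ge0_integral_posterior mnf)//.
apply: lte_sum_pinfty => j cj.
have [->|aj] := eqVneq (a j) 0; first by rewrite mul0r mul0e.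
have /integrableP[_] := fi j cj aj => fin.
by rewrite lte_mul_pinfty ?lee_fin ?posterior_weight_ge0.
Qed.

Lemma Rintegral_posterior f : measurable_fun setT f ->
  (forall j, compatible y j -> a j != 0 ->
    m.-integrable setT (EFin \o (fun x => f (tr j x)))) ->
  (\int[posterior m a y]_x f x =
   \sum_(j | compatible y j) w j * \int[m]_x f (tr j x))%R.
Proof.
have ge0 g : measurable_fun setT g -> (forall x, 0 <= g x) ->
    (forall j, compatible y j -> a j != 0 ->
      m.-integrable setT (EFin \o (fun x => g (tr j x)))) ->
    (\int[posterior m a y]_x g x =
     \sum_(j | compatible y j) w j * \int[m]_x g (tr j x))%R.
  move=> mg g0 gi; rewrite /Rintegral ge0_integral_posterior//.
  transitivity (fine (\sum_(j | compatible y j)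
      (w j * \int[m]_x g (tr j x))%R%:E)%E); last by rewrite sumEFin.
  congr fine; apply: eq_bigr => j cj.
  have [->|aj] := eqVneq (a j) 0; first by rewrite !mul0r mul0e.
  rewrite [RHS]EFinM [in RHS]/Rintegral fineK//.
  exact: (integrable_fin_num measurableT (gi j cj aj)).
move=> mf fi.
have ni j : compatible y j -> a j != 0 ->
    m.-integrable setT (EFin \o (fun x => `|f (tr j x)|)).
  by move=> cj aj; exact: integrable_norm (fi j cj aj).
have mn : measurable_fun setT (fun x => `|f x|) by exact: measurableT_comp.
(* [f] is [|f| - g] with both terms nonnegative and integrable, so the nonnegative case applies
   twice. *)
pose g x := `|f x| - f x.
have mg : measurable_fun setT g by exact: measurable_funB.
have gi j : compatible y j -> a j != 0 ->
    m.-integrable setT (EFin \o (fun x => g (tr j x))).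
  by move=> cj aj; apply: (integrableB measurableT (ni j cj aj) (fi j cj aj)).
have g0 x : 0 <= g x by rewrite subr_ge0 ler_norm.
rewrite (@eq_Rintegral _ _ _ _ _ (fun x => `|f x| - g x)); last first.
  by move=> x _; rewrite /g opprB addrC subrK.
rewrite RintegralB//; [|exact: integrable_posterior|exact: integrable_posterior].
rewrite ge0// ge0// -sumrB; apply: eq_bigr => j cj; rewrite -mulrBr.
have [->|aj] := eqVneq (a j) 0; first by rewrite !mul0r.
congr (_ * _); rewrite -RintegralB//; [|exact: ni|exact: gi].
by apply: eq_Rintegral => x _; rewrite /g opprB addrC subrK.
Qed.

End posterior_integral.

End integration.

(** * Rounds of the game *)

Lemma le_sqrt_sum (R : rcfType) (I : finType) (F : I -> R) i :
  `|F i| <= Num.sqrt (\sum_i F i ^+ 2).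
Proof.
rewrite -sqrtr_sqr ler_wsqrtr// (bigD1 i)//= lerDl.
by apply: sumr_ge0 => k _; exact: sqr_ge0.
Qed.

Lemma le_sqrt_sum3 (R : rcfType) (I : finType) (F : I -> I -> I -> R) i j k :
  `|F i j k| <= Num.sqrt (\sum_i \sum_j \sum_k F i j k ^+ 2).
Proof.
rewrite pair_bigA pair_bigA /=.
exact: (le_sqrt_sum (fun p : I * I * I => F p.1.1 p.1.2 p.2) (i, j, k)).
Qed.

Section play.
Variables (R : realType) (K : nat).
Implicit Types (b : fdist R 'I_K) (a : fdist R {set 'I_K}).

Lemma fdist_le1 (F : finType) (p : fdist R F) f : p f <= 1.
Proof.
rewrite -(fdist_sum1 p) (bigD1 f)//= lerDl.
by apply: sumr_ge0 => g _; exact: fdist_ge0.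
Qed.

Definition fdist_dirac_fun (F : finType) (f : F) (g : F) : R := (g == f)%:R.

Lemma fdist_dirac_ge0 (F : finType) (f g : F) : 0 <= fdist_dirac_fun f g.
Proof. by []. Qed.

Lemma fdist_dirac_sum1 (F : finType) (f : F) : \sum_g fdist_dirac_fun f g = 1.
Proof. by rewrite (bigD1 f)//= /fdist_dirac_fun eqxx big1 ?addr0// => g /negbTE->. Qed.

Definition fdist_dirac (F : finType) (f : F) : fdist R F :=
  FDist (fdist_dirac_ge0 f) (fdist_dirac_sum1 f).

Definition play_mean b a (F : 'I_K -> {set 'I_K} -> R) : R :=
  \sum_i b i * \sum_j a j * F i j.

Lemma play_meanD b a F G :
  play_mean b a (fun i j => F i j + G i j) = play_mean b a F + play_mean b a G.
Proof.
rewrite /play_mean -big_split/=; apply: eq_bigr => i _.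
by rewrite -mulrDr -big_split/=; congr (_ * _); apply: eq_bigr => j _; rewrite mulrDr.
Qed.

Lemma play_meanZ b a k F :
  play_mean b a (fun i j => k * F i j) = k * play_mean b a F.
Proof.
rewrite /play_mean mulr_sumr; apply: eq_bigr => i _; rewrite [RHS]mulrCA [X in _ = _ * X]mulr_sumr.
by congr (_ * _); apply: eq_bigr => j _; rewrite mulrCA.
Qed.

Lemma play_mean_cst b a k : play_mean b a (fun _ _ => k) = k.
Proof.
rewrite /play_mean; under eq_bigr do rewrite -mulr_suml fdist_sum1 mul1r.
by rewrite -mulr_suml fdist_sum1 mul1r.
Qed.

Lemma le_play_mean b a F G : (forall i j, F i j <= G i j) ->
  play_mean b a F <= play_mean b a G.
Proof.
move=> FG; apply: ler_sum => i _; rewrite ler_wpM2l ?fdist_ge0//.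
by apply: ler_sum => j _; rewrite ler_wpM2l ?fdist_ge0.
Qed.

Lemma play_mean_pair b a F :
  play_mean b a F = \sum_(p : 'I_K * {set 'I_K}) (b p.1 * a p.2) * F p.1 p.2.
Proof.
rewrite /play_mean; under eq_bigr do rewrite mulr_sumr.
by rewrite pair_bigA/=; apply: eq_bigr => p _; rewrite mulrA.
Qed.

(** When [i] belongs to [j], [e_j - e = - e_(j^c)]. The move of the state is thus the translation
    used in [posterior], which ties the game to the beliefs. *)
Lemma increment_shift (i : 'I_K) (j : {set 'I_K}) :
  increment R i j = shift_of R (signal_of i j) j.
Proof.
rewrite /increment /shift_of /signal_of/=; case: ifPn => ij.
  apply/rowP => l; rewrite !mxE finset.in_setC mul1r.
  by case: (l \in j); rewrite ?subrr ?sub0r ?oppr0.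
by rewrite scale0r subr0.
Qed.

Lemma norm_increment (i : 'I_K) (j : {set 'I_K}) l : `|increment R i j ord0 l| <= 1.
Proof.
rewrite !mxE mulr1; case: (l \in j); case: (i \in j);
  by rewrite ?subrr ?subr0 ?sub0r ?normrN ?normr0 ?normr1 ?ler01.
Qed.

Lemma increment0 (i : 'I_K) : increment R i finset.set0 = 0.
Proof. by apply/rowP => l; rewrite !mxE !inE mul0r subr0. Qed.

(** [diffusion i a] is the second moment matrix of the increment given [I_n = i]; the sign of
    [- e_(j^c)] disappears in the outer product. *)
Lemma tr_diffusion (H : 'M[R]_K) (i : 'I_K) a :
  \tr (H *m diffusion i a) = \sum_j a j *
    \sum_s \sum_r increment R i j ord0 s * increment R i j ord0 r * H r s.
Proof.
rewrite /diffusion mulmx_sumr raddf_sum/=; apply: eq_bigr => j _.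
rewrite -scalemxAr mxtraceZ; congr (_ * _).
have -> : (if i \in j then (ind (~: j))^T *m ind (~: j) else (ind j)^T *m ind j)
    = (increment R i j)^T *m increment R i j.
  rewrite increment_shift /shift_of /=; case: ifP => // _.
  by rewrite mulmxN -mulNmx; congr (_ *m _); apply/matrixP => r s; rewrite !mxE opprK.
rewrite exchange_big/=; apply: eq_bigr => r _; rewrite mxE; apply: eq_bigr => s _.
by rewrite mxE big_ord1 mxE mulrC.
Qed.

Lemma le_generator (f : R -> 'rV[R]_K -> R) t x i a :
  \tr (hessian f t x *m diffusion i a) <= generator f t x.
Proof.
pose Q i j := \sum_s \sum_r increment R i j ord0 s * increment R i j ord0 r
  * hessian f t x r s.
apply: ub_le_sup; last by exists i => //; exists a.
(* A bound common to all [i] and [a], since the weights [a j] are at most 1; the real [sup] is an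
   upper bound only once the set is bounded. *)
exists (\sum_i \sum_j `|Q i j|) => _ [i' _ [a' _ <-]].
rewrite tr_diffusion (bigD1 i')//=.
apply: (@le_trans _ _ (\sum_j `|Q i' j|)).
  apply: ler_sum => j _; rewrite -/(Q i' j).
  apply: (le_trans (ler_norm _)); rewrite normrM.
  by rewrite ler_piMl// ger0_norm ?fdist_le1 ?fdist_ge0.
by rewrite lerDl; apply: sumr_ge0 => k _; apply: sumr_ge0.
Qed.

(** The pure action on the empty set never moves the state, so its trace is 0. With the PDE this
    makes [phi] nonincreasing in time. *)
Lemma generator_ge0 (f : R -> 'rV[R]_K -> R) t x :
  (0 < K)%N -> 0 <= generator f t x.
Proof.
move=> K0; apply: le_trans (le_generator f t x (Ordinal K0) (fdist_dirac finset.set0)).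
rewrite tr_diffusion big1// => j _; rewrite /= /fdist_dirac_fun.
have [->|_] := eqVneq j finset.set0; last by rewrite mul0r.
rewrite mul1r big1// => s _; rewrite big1// => r _.
by rewrite increment0 mxE !mul0r.
Qed.

End play.

(** * Growth of the harmonic sum *)

Section harmonic_sum.
Variable R : realType.

Definition harmonic_sum (k : nat) : R := \sum_(l < k) l.+1%:R^-1.

(* With [p ^ 4 = k + 1] and [q ^ 4 = k], [1 = p ^ 4 - q ^ 4 <= 4 p ^ 3 (p - q)]
   and [p >= 1], so that [1 / (k + 1) <= 4 (p - q)]. *)
Lemma harmonic_sum_le k : harmonic_sum k <= 4 * Num.sqrt (Num.sqrt k%:R).
Proof.
elim: k => [|k IH]; first by rewrite /harmonic_sum big_ord0 mulr_ge0// sqrtr_ge0.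
rewrite /harmonic_sum big_ord_recr/= -/(harmonic_sum k).
set p := Num.sqrt (Num.sqrt k.+1%:R); set q := Num.sqrt (Num.sqrt k%:R) in IH *.
have root4 n : Num.sqrt (Num.sqrt n%:R) ^+ 4 = n%:R :> R.
  by rewrite (exprM _ 2 2) !sqr_sqrtr// sqrtr_ge0.
have p4 : p ^+ 4 = k%:R + 1 by rewrite root4 natr1.
have q4 : q ^+ 4 = k%:R := root4 k.
have q0 : 0 <= q by rewrite sqrtr_ge0.
have qp : q <= p by rewrite !ler_wsqrtr// ler_nat.
have p1 : 1 <= p by rewrite -[leLHS]sqrtr1 ler_wsqrtr// -[leLHS]sqrtr1 ler_wsqrtr// ler1n.
have k0 : 0 < k.+1%:R :> R by rewrite ltr0n.
have qp2 : q ^+ 2 <= p ^+ 2 by rewrite lerXn2r ?nnegrE// (le_trans q0).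
have step1 : 1 <= (p - q) * (4 * p ^+ 3).
  rewrite [leLHS](_ : 1 = (p - q) * ((p + q) * (p ^+ 2 + q ^+ 2))); last first.
    by rewrite -[LHS](addrK k%:R) [1 + _]addrC -p4 -q4; ring.
  apply: ler_wpM2l; first by rewrite subr_ge0.
  rewrite (_ : 4 * p ^+ 3 = (2 * p) * (2 * p ^+ 2)); last by ring.
  have p0 : 0 <= p by rewrite (le_trans q0).
  apply: ler_pM; [lra|by rewrite addr_ge0// sqr_ge0|lra|lra].
suff H : k.+1%:R^-1 <= 4 * (p - q).
  by apply: (le_trans (lerD IH H)); rewrite -mulrDr addrC subrK.
rewrite -[X in X <= _]mul1r ler_pdivrMr// -(root4 k.+1) -/p.
apply: (le_trans step1); rewrite (_ : 4 * (p - q) * p ^+ 4 = (p - q) * (4 * p ^+ 3) * p).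
  by rewrite ler_peMr// (le_trans ler01).
by ring.
Qed.

End harmonic_sum.

(** * Expected final maximum given the hidden state *)

Section value.
Variables (R : realType) (K : nat).
Variables (alpha : adversary R K) (beta : forecaster R K).
Local Notation E := (state R K).

(** The state [x] is an argument although the strategies see only [h]: this allows integration
    against any belief. *)
Fixpoint value (n : nat) (h : seq (round R K)) (x : 'rV[R]_K) : R :=
  if n isn't n'.+1 then maxcoord x else
  play_mean (beta h) (alpha h) (fun i j =>
    value n' (rcons h (alpha h, signal_of i j)) (x + increment R i j)).

Definition history_from (h : seq (round R K)) (w : seq ('I_K * {set 'I_K})) :=
  foldl (fun h ij => rcons h (alpha h, signal_of ij.1 ij.2)) h w.

Lemma sum_tupleS (A : finType) n (F : n.+1.-tuple A -> R) :
  \sum_w F w = \sum_a \sum_(w : n.-tuple A) F [tuple of a :: w].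
Proof.
rewrite pair_bigA /= (reindex (fun p : A * n.-tuple A => [tuple of p.1 :: p.2]))//=.
exists (fun t => (thead t, [tuple of behead t])) => [[a w] _|t _] /=.
  by congr (_, _); apply: val_inj.
by rewrite -tuple_eta.
Qed.

(** Unfolding the first round peels the head of the path; [history_from] is needed because the rest
    of the path starts from a nonempty history. *)
Lemma value_sum n h x :
  value n h x = \sum_(w : n.-tuple ('I_K * {set 'I_K}))
    (\prod_(k < n) (beta (history_from h (take k w)) (tnth w k).1
                    * alpha (history_from h (take k w)) (tnth w k).2))
    * maxcoord (x + \sum_(k < n) increment R (tnth w k).1 (tnth w k).2).
Proof.
elim: n h x => [|n IH] h x.
  rewrite (eq_bigr (fun=> maxcoord x)) => [|w _].
    by rewrite sumr_const card_tuple expn0 mulr1n.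
  by rewrite !big_ord0 addr0 mul1r.
rewrite sum_tupleS [LHS]/= play_mean_pair; apply: eq_bigr => -[i j] _.
rewrite IH !mulr_sumr; apply: eq_bigr => w _.
rewrite !big_ord_recl !tnth0.
rewrite [LHS]mulrA [in RHS]addrA; apply: (congr2 *%R).
  by apply: (congr2 *%R) => //; apply: eq_bigr => k _; rewrite !tnthS.
apply: (congr1 (@maxcoord R K)); apply: (congr1 (+%R _)).
by apply: eq_bigr => k _; rewrite !tnthS.
Qed.

Lemma regret_value T (m0 : probability E R) :
  regret T m0 alpha beta = (\int[m0]_x (value T [::] x)%:E)%E.
Proof. by rewrite /regret; apply: eq_integral => x _; rewrite value_sum. Qed.

(** Coordinates of an increment are at most 1 in absolute value. Hence [value] is integrable as soon
    as [maxcoord] is, whatever the strategies. *)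
Lemma value_maxcoord n h x : (0 < K)%N -> `|value n h x - maxcoord x| <= n%:R.
Proof.
move=> K0; elim: n h x => [|n IH] h x; first by rewrite /= subrr normr0.
have vb i j : `|value n (rcons h (alpha h, signal_of i j)) (x + increment R i j)
    - maxcoord x| <= n.+1%:R.
  rewrite -[X in `|X - _|](subrK (maxcoord (x + increment R i j))) -addrA.
  rewrite (le_trans (ler_normD _ _))// -natr1 lerD// maxcoord_lipschitz// => l.
  exact: norm_increment.
rewrite /= -[X in _ - X](play_mean_cst (beta h) (alpha h)) ler_norml; apply/andP; split.
  rewrite lerBrDr -[X in X + _](play_mean_cst (beta h) (alpha h)) -play_meanD.
  apply: le_play_mean => i j; rewrite -lerBrDr.
  by have := vb i j; rewrite ler_norml => /andP[].
rewrite lerBlDr -[X in X + _](play_mean_cst (beta h) (alpha h)) -play_meanD.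
apply: le_play_mean => i j; rewrite -lerBlDr.
by have := vb i j; rewrite ler_norml => /andP[].
Qed.

Lemma measurable_value n h : (0 < K)%N -> measurable_fun setT (value n h : E -> R).
Proof.
move=> K0; elim: n h => [|n IH] h.
  exact: measurable_maxcoord.
apply: measurable_sum => i; apply: measurable_funM; first exact: measurable_cst.
apply: measurable_sum => j; apply: measurable_funM; first exact: measurable_cst.
exact: measurable_comp_translate.
Qed.

End value.

(** * Integrability of real functions and averages over a play *)

Section real_integration.
Context d (T : measurableType d) (R : realType).
Variable m : probability T R.
Implicit Types f g : T -> R.
Local Notation intg f := (m.-integrable setT (EFin \o f)).

Lemma integrable_measurable f : intg f -> measurable_fun setT f.
Proof. by move=> /integrableP[/measurable_EFinP]. Qed.

Lemma integrable_addr f g : intg f -> intg g -> intg (fun x => f x + g x).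
Proof. by move=> fi gi; apply: (integrableD measurableT fi gi). Qed.

Lemma integrable_subr f g : intg f -> intg g -> intg (fun x => f x - g x).
Proof. by move=> fi gi; apply: (integrableB measurableT fi gi). Qed.

Lemma integrable_mulr (k : R) f : intg f -> intg (fun x => k * f x).
Proof. by move=> fi; apply: (integrableZl measurableT k fi). Qed.

Lemma integrable_real_cst (k : R) : intg (fun=> k).
Proof. exact: finite_measure_integrable_cst. Qed.

Lemma integrable_squeeze f g : measurable_fun setT f -> intg g ->
  (forall x, 0 <= f x <= g x) -> intg f.
Proof.
move=> mf gi fg; apply: (le_integrable measurableT _ _ gi).
  exact/measurable_EFinP.
move=> x _ /=; have /andP[f0 fgx] := fg x.
by rewrite lee_fin !ger0_norm// (le_trans f0).
Qed.

Lemma integrable_near f g (r : R) : measurable_fun setT f -> intg g ->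
  (forall x, `|f x - g x| <= r) -> intg f.
Proof.
move=> mf gi fg.
have hi := integrable_addr (integrable_norm gi) (integrable_real_cst r).
apply: (le_integrable measurableT _ _ hi); first exact/measurable_EFinP.
move=> x _ /=; rewrite lee_fin [leRHS]ger0_norm; last first.
  by rewrite addr_ge0// (le_trans _ (fg x)).
by rewrite -lerBlDl; apply: le_trans (fg x); exact: lerB_dist.
Qed.

(** Terms with coefficient 0 are not asked to be integrable: a bound on the mean over a play says
    nothing about pairs played with probability 0. *)
Lemma integrable_Rintegral_sum (I : Type) (s : seq I) (c : I -> R) (F : I -> T -> R) :
  (forall i, c i != 0 -> intg (F i)) ->
  intg (fun x => \sum_(i <- s) c i * F i x) /\
  (\int[m]_x (\sum_(i <- s) c i * F i x) = \sum_(i <- s) c i * \int[m]_x F i x)%R.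
Proof.
move=> Fi; elim: s => [|i s [IH1 IH2]].
  under eq_fun do rewrite big_nil.
  by split; [exact: integrable_real_cst|rewrite Rintegral_cst// mul0r big_nil].
have ci : intg (fun x => c i * F i x) /\
    (\int[m]_x (c i * F i x) = c i * \int[m]_x F i x)%R.
  have [->|c0] := eqVneq (c i) 0.
    under eq_fun do rewrite mul0r.
    by split; [exact: integrable_real_cst|rewrite Rintegral_cst// !mul0r].
  by split; [apply: integrable_mulr; exact: Fi|rewrite RintegralZl//; exact: Fi].
under eq_fun do rewrite big_cons.
split; first by apply: integrable_addr => //; exact: ci.1.
by rewrite RintegralD// ?ci.2 ?IH2 ?big_cons//; exact: ci.1.
Qed.

Lemma integrable_funeposneg f : measurable_fun setT f ->
  (\int[m]_x ((EFin \o f)^\+ x) < +oo)%E -> (\int[m]_x ((EFin \o f)^\- x) < +oo)%E ->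
  intg f.
Proof.
move=> mf fp fn; have mE : measurable_fun setT (EFin \o f) by exact/measurable_EFinP.
apply/integrableP; split => //.
rewrite (eq_integral ((EFin \o f)^\+ \+ (EFin \o f)^\-)%E); last first.
  by move=> x _; rewrite -[LHS]/((abse \o (EFin \o f)) x) fune_abse.
rewrite ge0_integralD//.
- exact: lte_add_pinfty.
- exact: measurable_funepos.
- exact: measurable_funeneg.
Qed.

Lemma integrable_fin_integral f : measurable_fun setT f ->
  (\int[m]_x (f x)%:E)%E \is a fin_num -> intg f.
Proof.
move=> mf ffin; apply/integrableP; split; first exact/measurable_EFinP.
by rewrite integral_fin_num_abs.
Qed.

End real_integration.

Section play_integration.
Variables (R : realType) (K : nat).
Local Notation E := (state R K).
Variable m : probability E R.
Implicit Types (b : fdist R 'I_K) (a : fdist R {set 'I_K}).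
Local Notation intg f := (m.-integrable setT (EFin \o f)).

Lemma integrable_Rintegral_play_mean b a (F : 'I_K -> {set 'I_K} -> E -> R) :
  (forall i j, b i * a j != 0 -> intg (F i j)) ->
  intg (fun x => play_mean b a (fun i j => F i j x)) /\
  (\int[m]_x (play_mean b a (fun i j => F i j x)) =
   play_mean b a (fun i j => \int[m]_x F i j x))%R.
Proof.
move=> Fi; rewrite play_mean_pair; under eq_fun do rewrite play_mean_pair.
by apply: integrable_Rintegral_sum => -[i j]; exact: Fi.
Qed.

Lemma signal_prob_neq0 (i : 'I_K) a (j : {set 'I_K}) :
  a j != 0 -> signal_prob a (signal_of i j) != 0.
Proof.
move=> aj; have cj : compatible (signal_of i j) j by rewrite /compatible eqxx.
rewrite gt_eqF// /signal_prob (bigD1 j)//=.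
apply: ltr_wpDr; first by apply: sumr_ge0 => k _; exact: fdist_ge0.
by rewrite lt_neqAle eq_sym aj fdist_ge0.
Qed.

Lemma signal_prob_sum (i : 'I_K) a : \sum_(s : bool) signal_prob a (i, s) = 1.
Proof.
rewrite -(fdist_sum1 a) (partition_big (fun j : {set 'I_K} => i \in j) xpredT)//=.
Qed.

(** Conditioning on the signal. For fixed [i] the subsets split according to whether they contain
    [i], and each class, normalized, gives the mixture defining [posterior]. A signal of probability
    0 forces [a j = 0] on its class, so the default value of [posterior] is multiplied by 0. *)
Lemma play_mean_posterior b a (f : signal K -> E -> R) :
  (forall y, measurable_fun setT (f y)) ->
  (forall i j, b i * a j != 0 ->
    intg (fun x => f (signal_of i j) (x + increment R i j))) ->
  play_mean b a (fun i j => \int[m]_x f (signal_of i j) (x + increment R i j))%R =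
  \sum_i b i * \sum_(s : bool) signal_prob a (i, s)
    * (\int[posterior m a (i, s)]_x f (i, s) x)%R.
Proof.
move=> mf fi; rewrite /play_mean; apply: eq_bigr => i _.
have [->|bi] := eqVneq (b i) 0; first by rewrite !mul0r.
congr (_ * _); rewrite (partition_big (fun j : {set 'I_K} => i \in j) xpredT)//=.
apply: eq_bigr => s _.
have sgn (j : {set 'I_K}) : (i \in j) == s -> signal_of i j = (i, s) by move=> /eqP <-.
have [p0|p0] := eqVneq (signal_prob a (i, s)) 0.
  rewrite p0 mul0r big1// => j js; rewrite (_ : a j = 0) ?mul0r//; apply/eqP.
  by apply: contraT => aj; have := signal_prob_neq0 i aj; rewrite sgn// p0 eqxx.
rewrite Rintegral_posterior//; last first.
  move=> j js aj; have := fi i j; rewrite mulf_neq0// => /(_ isT).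
  by rewrite increment_shift sgn.
rewrite mulr_sumr; apply: eq_bigr => j js.
rewrite mulrA mulrCA mulfV// mulr1 increment_shift sgn//.
Qed.

End play_integration.

(** * One step of the verification argument *)

Section supersolution.
Variables (R : realType) (K : nat) (phi : R -> 'rV[R]_K -> R) (C : R).
Implicit Types (s t : R) (x z : 'rV[R]_K).
Hypothesis K_gt0 : (0 < K)%N.
Hypothesis phi_classical : classical phi.
Hypothesis phi_pde :
  forall t x, 0 <= t < 1 -> 0 >= dt phi t x + 2^-1 * generator phi t x.
Hypothesis phi_term : forall x, phi 1 x >= maxcoord x.
Hypothesis C_gt0 : 0 < C.
Hypothesis phi_higher : forall t x, 0 <= t < 1 -> higher_derivable phi t x.
Hypothesis phi_tt : forall t x, 0 <= t < 1 ->
  `|dt (dt phi) t x| <= C / (1 - t) `^ (3 / 2).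
Hypothesis phi_xxx_tx : forall t x, 0 <= t < 1 ->
  norm_dxxx phi t x + norm_dtx phi t x <= C / (1 - t).

Lemma dt_le0 t x : 0 <= t < 1 -> dt phi t x <= 0.
Proof.
move=> t01; have := phi_pde x t01; have := generator_ge0 phi t x K_gt0.
by lra.
Qed.

Lemma phi_continuous_time z (A : set R) :
  (forall s, A s -> 0 <= s <= 1) -> {within A, continuous (phi^~ z)}.
Proof. by move=> A01; have [c _ _ _] := phi_classical; apply: continuous_on_time c _ => s /A01. Qed.

Lemma phi_is_derive_time t x : 0 < t < 1 -> is_derive t 1 (phi^~ x) (dt phi t x).
Proof.
move=> t01; apply: is_derive_time => //; have [_ [+ _] _ _] := phi_classical; apply.
by case/andP : t01 => /ltW -> ->.
Qed.

Lemma phi_nonincreasing s t x : 0 <= s -> s <= t -> t <= 1 -> phi t x <= phi s x.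
Proof.
move=> s0; rewrite le_eqVlt => /predU1P[->//|st] t1.
have [||r /[!in_itv]/= /andP[sr rt] E] := @MVT R (phi^~ x) (fun r => dt phi r x) s t st.
- move=> r; rewrite in_itv/= => /andP[sr rt]; apply: phi_is_derive_time.
  by apply/andP; split; lra.
- by apply: phi_continuous_time => r /=; rewrite in_itv/= => /andP[? ?]; apply/andP; split; lra.
rewrite -subr_le0 E; apply: mulr_le0_ge0; last by rewrite subr_ge0 ltW.
by apply: dt_le0; apply/andP; split; lra.
Qed.

Lemma maxcoord_le_phi t x : 0 <= t <= 1 -> maxcoord x <= phi t x.
Proof.
move=> /andP[t0 t1]; apply: le_trans (phi_term x) _.
exact: phi_nonincreasing.
Qed.

Lemma dtx_bound t x i : 0 <= t < 1 -> `|dx i (dt phi) t x| <= C / (1 - t).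
Proof.
move=> t01; apply: le_trans (phi_xxx_tx x t01).
apply: (@le_trans _ _ (norm_dtx phi t x)); last by rewrite lerDr sqrtr_ge0.
exact: (le_sqrt_sum (fun i => dx i (dt phi) t x)).
Qed.

Lemma dxxx_bound t x i j k : 0 <= t < 1 ->
  `|dx i (dx j (dx k phi)) t x| <= C / (1 - t).
Proof.
move=> t01; apply: le_trans (phi_xxx_tx x t01).
apply: (@le_trans _ _ (norm_dxxx phi t x)); last by rewrite lerDl sqrtr_ge0.
exact: (le_sqrt_sum3 (fun i j k => dx i (dx j (dx k phi)) t x)).
Qed.

Lemma phi_time_step s t x : 0 <= s -> s < t -> t <= 1 ->
  phi t x <= phi s x + (t - s) * dt phi s x
    + (4 * C * (Num.sqrt (1 - s) - Num.sqrt (1 - t))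
       - (t - s) * (2 * C / Num.sqrt (1 - s))).
Proof.
move=> s0 st t1.
have mid r : r \in `]s, t[%R -> 0 < r < 1.
  by rewrite in_itv/= => /andP[sr rt]; apply/andP; split; lra.
have mid' (r : R) : 0 < r < 1 -> 0 <= r < 1 by move=> /andP[/ltW -> ->].
have c0 : {within `[s, t], continuous (phi^~ x)}.
  apply: phi_continuous_time => r /=; rewrite in_itv/= => /andP[? ?].
  by apply/andP; split; lra.
have d0 r : r \in `]s, t[%R -> is_derive r 1 (phi^~ x) (dt phi r x).
  by move=> /mid; exact: phi_is_derive_time.
have c1 : {within `[s, t[, continuous ((dt phi)^~ x)}.
  have [_ [_ c] _ _] := phi_classical; apply: continuous_on_time c _ => r /=.
  by rewrite in_itv/= /strip/= => /andP[? ?]; apply/andP; split; lra.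
have d1 r : r \in `]s, t[%R -> is_derive r 1 ((dt phi)^~ x) (dt (dt phi) r x).
  move=> /mid r01; apply: is_derive_time => //.
  by have [] := phi_higher x (mid' _ r01).
have d2 r : r \in `]s, t[%R -> dt (dt phi) r x <= C / (1 - r) `^ (3 / 2).
  by move=> /mid/mid' r01; apply: le_trans (ler_norm _) (phi_tt x r01).
exact: (sqrt_time_bound st t1 c0 d0 c1 d1 d2).
Qed.

Lemma sum_norm_le (c : R) (v : 'rV[R]_K) :
  (forall l, `|v ord0 l| <= c) -> \sum_l `|v ord0 l| <= K%:R * c.
Proof.
move=> vc; apply: (@le_trans _ _ (\sum_(l < K) c)); first exact: ler_sum.
by rewrite sumr_const card_ord mulr_natl.
Qed.

(** Along the segment a Hessian entry varies by at most [C / (1 - t) * (K c)], its derivatives being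
    bounded; [K c] bounds the l1 norm of [v], whence the cube. *)
Lemma phi_space_step (t : R) x (v : 'rV[R]_K) (c : R) :
  0 <= t < 1 -> 0 <= c -> (forall l, `|v ord0 l| <= c) ->
  phi t (x + v) <= phi t x + \sum_l v ord0 l * dx l phi t x
    + 2^-1 * (\sum_s \sum_r v ord0 s * v ord0 r * hessian phi t x r s)
    + 2^-1 * (C / (1 - t) * (K%:R * c) ^+ 3).
Proof.
move=> t01 c0 vc; have [_ _ [xd xc] [xxd xxc]] := phi_classical.
have Ct : 0 <= C / (1 - t) by rewrite divr_ge0 ?ltW// subr_gt0; case/andP : t01.
have Kc0 : 0 <= K%:R * c by rewrite mulr_ge0.
have onstrip z : strip (t, z) by [].
apply: le_trans (@taylor2_row _ _ _ _ _ (C / (1 - t) * (K%:R * c)) _ _ _ _ _) _.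
- by move=> i y; exact: xd.
- by move=> i; exact: (continuous_on_space (xc i)).
- by move=> i j y; exact: xxd.
- by move=> i j; exact: (continuous_on_space (xxc i j)).
- move=> i j s /andP[s0 s1].
  have := @lipschitz_row _ _ (dx i (dx j phi) t) x (s *: v) (C / (1 - t)).
  move=> /(_ _ _)/le_trans; apply.
  + by move=> k y; have [_ _] := phi_higher y t01; apply.
  + by move=> k y; exact: (dxxx_bound y k i j t01).
  rewrite ler_wpM2l//; apply: sum_norm_le => l.
  by rewrite mxE normrM ger0_norm//; apply: le_trans (vc l); rewrite ler_piMl.
have -> : \sum_s \sum_r v ord0 s * v ord0 r * hessian phi t x r s
    = \sum_s \sum_r v ord0 s * v ord0 r
        * 'D_(unit_vec R r) ('D_(unit_vec R s) (phi t)) x.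
  by apply: eq_bigr => s _; apply: eq_bigr => r _; rewrite mxE.
rewrite lerD2l ler_wpM2l// -mulrA [(K%:R * c) ^+ 3]exprS ler_wpM2l// ler_wpM2l//.
by rewrite lerXn2r ?nnegrE ?sumr_ge0// sum_norm_le.
Qed.

(** The time expansion is made at the displaced point, while the PDE is used at [x]: the mixed
    derivatives bound the difference. *)
Lemma dt_space_step (t : R) x (v : 'rV[R]_K) (c : R) :
  0 <= t < 1 -> (forall l, `|v ord0 l| <= c) ->
  dt phi t (x + v) <= dt phi t x + C / (1 - t) * (K%:R * c).
Proof.
move=> t01 vc; rewrite -lerBlDl; apply: (le_trans (ler_norm _)).
have := @lipschitz_row _ _ (dt phi t) x v (C / (1 - t)).
move=> /(_ _ _)/le_trans; apply.
- by move=> i y; have [_ + _] := phi_higher y t01; apply.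
- by move=> i y; exact: dtx_bound.
rewrite ler_wpM2l ?sum_norm_le// divr_ge0 ?ltW// subr_gt0.
by case/andP : t01.
Qed.

(** Here [c ^+ 2] is the time step and [k] the number of rounds to go. With [p] and [q] the two
    roots, [c ^+ 2 = (p - q) (p + q)] turns the left side into [2 C (p - q) ^+ 2 / p]; then
    [(p - q) p <= c ^+ 2] and [c <= p] conclude, also in the last round, where [q = 0]. *)
Lemma time_remainder_le (c k : R) : 0 < c -> 1 <= k ->
  4 * C * (Num.sqrt (k * c ^+ 2) - Num.sqrt ((k - 1) * c ^+ 2))
    - c ^+ 2 * (2 * C / Num.sqrt (k * c ^+ 2)) <= 2 * C * c / k.
Proof.
move=> c0 k1.
have k0 : 0 < k by rewrite (lt_le_trans ltr01).
set p := Num.sqrt (k * _); set q := Num.sqrt ((k - 1) * _).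
have p2 : p ^+ 2 = k * c ^+ 2 by rewrite sqr_sqrtr// mulr_ge0 ?sqr_ge0// ltW.
have q2 : q ^+ 2 = (k - 1) * c ^+ 2 by rewrite sqr_sqrtr// mulr_ge0 ?sqr_ge0// subr_ge0.
have p0 : 0 < p by rewrite sqrtr_gt0 mulr_gt0// exprn_gt0.
have q0 : 0 <= q by rewrite sqrtr_ge0.
have cp : c <= p.
  have := @ler_sqr _ c p; rewrite !nnegrE => /(_ (ltW c0) (ltW p0)) <-.
  by rewrite p2 ler_peMl ?sqr_ge0.
have pq : (p - q) * (p + q) = c ^+ 2 by rewrite -subr_sqr p2 q2; ring.
have pq0 : 0 <= p - q by rewrite -(@pmulr_lge0 _ (p + q)) ?pq ?sqr_ge0// ltr_wpDr.
have pq1 : (p - q) * p <= c ^+ 2 by rewrite -pq ler_wpM2l// lerDl.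
have -> : 4 * C * (p - q) - c ^+ 2 * (2 * C / p) = 2 * C * ((p - q) ^+ 2 / p).
  by rewrite -pq; field; rewrite gt_eqF.
rewrite -[2 * C * c / k]mulrA; apply: ler_wpM2l; first by rewrite mulr_ge0// ltW.
rewrite ler_pdivrMr// mulrAC ler_pdivlMr//.
have kE : k = p ^+ 2 / c ^+ 2 by rewrite p2 mulfK// gt_eqF// exprn_gt0.
rewrite kE mulrA ler_pdivrMr ?exprn_gt0// -exprMn.
apply: (@le_trans _ _ ((c ^+ 2) ^+ 2)).
  by rewrite lerXn2r ?nnegrE ?sqr_ge0// mulr_ge0// ltW.
by rewrite -mulrA [p * _]mulrC mulrA -exprS (_ : (c ^+ 2) ^+ 2 = c ^+ 3 * c);
  [rewrite ler_wpM2l// exprn_ge0// ltW|ring].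
Qed.

(** The three summands come from the time remainder, from the change of [dt phi] under the
    displacement, and from the cubic Taylor remainder. *)
Definition step_const : R := C * (2 + K%:R + K%:R ^+ 3 / 2).

(** Time moves first, at the displaced point; then [phi t] and [dt phi t] are brought back to [x].
    As [1 - t = k c ^+ 2] with [k = T - n], each of the three errors is at most a multiple of
    [c / k]. *)
Lemma phi_step (T n : nat) (i : 'I_K) (j : {set 'I_K}) x (c t : R) :
  (n < T)%N -> c = (Num.sqrt T%:R)^-1 -> t = n%:R / T%:R ->
  phi (n.+1%:R / T%:R) (x + c *: increment R i j) <=
    phi t x + c * \sum_l increment R i j ord0 l * dx l phi t x
    + T%:R^-1 * (dt phi t x + 2^-1 * \sum_s \sum_r
        increment R i j ord0 s * increment R i j ord0 r * hessian phi t x r s)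
    + step_const * c / (T - n)%:R.
Proof.
move=> nT cE tE; set d := increment R i j.
have T0 : 0 < T%:R :> R by rewrite ltr0n (leq_ltn_trans _ nT).
have c0 : 0 < c by rewrite cE invr_gt0 sqrtr_gt0.
have c2 : c ^+ 2 = T%:R^-1 by rewrite cE exprVn sqr_sqrtr// ltW.
pose k : R := (T - n)%:R.
have kE : k = T%:R - n%:R by rewrite /k natrB// ltnW.
have k1 : 1 <= k by rewrite /k ler1n subn_gt0.
have k0 : 0 < k by rewrite (lt_le_trans ltr01).
have t1E : 1 - t = k * c ^+ 2 by rewrite kE c2 tE; field; rewrite gt_eqF.
have t'E : 1 - n.+1%:R / T%:R = (k - 1) * c ^+ 2.
  by rewrite kE c2 -natr1; field; rewrite gt_eqF.
have tt' : n.+1%:R / T%:R - t = c ^+ 2.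
  by rewrite c2 tE -natr1; field; rewrite gt_eqF.
have c20 : 0 < c ^+ 2 by rewrite exprn_gt0.
have t0 : 0 <= t by rewrite tE divr_ge0.
have t01 : 0 <= t < 1.
  by rewrite t0 -subr_gt0 t1E mulr_gt0.
have cdE l : (c *: d) ord0 l = c * d ord0 l by rewrite [LHS]mxE.
have dc l : `|(c *: d) ord0 l| <= c.
  by rewrite cdE normrM gtr0_norm// ler_piMr ?norm_increment// ltW.
have := @phi_time_step t (n.+1%:R / T%:R) (x + c *: d) t0.
have tlt : t < n.+1%:R / T%:R by rewrite -subr_gt0 tt'.
have tle1 : n.+1%:R / T%:R <= 1 :> R.
  by rewrite -subr_ge0 t'E mulr_ge0 ?subr_ge0// ltW.
move=> /(_ tlt tle1); rewrite tt' t'E t1E => Htime; have Hrem := time_remainder_le c0 k1.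
have := phi_space_step x t01 (ltW c0) dc; rewrite t1E => Hspace.
have := dt_space_step x t01 dc; rewrite t1E => Hdt.
have {}Hdt := ler_wpM2l (ltW c20) Hdt.
have -> : \sum_l d ord0 l * dx l phi t x = c^-1 * \sum_l (c *: d) ord0 l * dx l phi t x.
  rewrite mulr_sumr; apply: eq_bigr => l _.
  by rewrite cdE !mulrA mulVf ?mul1r// gt_eqF.
rewrite mulVKf ?gt_eqF//.
set S := \sum_s _; have SE : c ^+ 2 * S = \sum_s \sum_r
    (c *: d) ord0 s * (c *: d) ord0 r * hessian phi t x r s.
  rewrite mulr_sumr; apply: eq_bigr => s _; rewrite mulr_sumr; apply: eq_bigr => r _.
  by rewrite !cdE; ring.
rewrite -SE in Hspace; rewrite -c2 -/k.
have e1 : c ^+ 2 * (C / (k * c ^+ 2) * (K%:R * c)) = C * K%:R * (c / k).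
  by field; rewrite !gt_eqF.
have e2 : 2^-1 * (C / (k * c ^+ 2) * (K%:R * c) ^+ 3) = C * K%:R ^+ 3 / 2 * (c / k).
  by field; rewrite !gt_eqF.
rewrite e2 in Hspace; rewrite mulrDr e1 in Hdt.
have -> : step_const * c / k
    = 2 * C * c / k + C * K%:R * (c / k) + C * K%:R ^+ 3 / 2 * (c / k).
  by rewrite /step_const; field; rewrite gt_eqF.
rewrite -c2 in Htime; lra.
Qed.

(** For each [i] the mean over [j] of the quadratic terms is a trace against [diffusion i a], hence
    below [generator], and the PDE removes the [1 / T] term for every pair of actions. The
    first-order term is kept, as it cancels only under the belief. *)
Lemma phi_mean_step (T n : nat) (b : fdist R 'I_K) (a : fdist R {set 'I_K}) x (c t : R) :
  (n < T)%N -> c = (Num.sqrt T%:R)^-1 -> t = n%:R / T%:R ->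
  play_mean b a (fun i j => phi (n.+1%:R / T%:R) (x + c *: increment R i j)) <=
    phi t x
    + c * play_mean b a (fun i j => \sum_l increment R i j ord0 l * dx l phi t x)
    + step_const * c / (T - n)%:R.
Proof.
move=> nT cE tE.
apply: le_trans (le_play_mean _ _ (fun i j => phi_step i j x nT cE tE)) _.
rewrite !play_meanD !play_mean_cst !play_meanZ lerD2r gerDl.
have T0 : 0 < T%:R :> R by rewrite ltr0n (leq_ltn_trans _ nT).
have t01 : 0 <= t < 1.
  by rewrite tE divr_ge0//= ltr_pdivrMr// mul1r ltr_nat.
rewrite pmulr_rle0 ?invr_gt0// play_meanD play_mean_cst play_meanZ.
apply: le_trans (phi_pde x t01); rewrite lerD2l ler_wpM2l//.
rewrite -[leRHS](play_mean_cst b a) /play_mean.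
apply: ler_sum => i _; rewrite ler_wpM2l ?fdist_ge0// -tr_diffusion.
by rewrite -mulr_suml fdist_sum1 mul1r le_generator.
Qed.

Lemma phi_measurable t : 0 <= t <= 1 ->
  measurable_fun setT (phi t : state R K -> R).
Proof.
move=> t01; have [c _ _ _] := phi_classical.
by apply: continuous_row_measurable; exact: (continuous_on_space c).
Qed.

Lemma dx_measurable i t : 0 <= t < 1 ->
  measurable_fun setT (dx i phi t : state R K -> R).
Proof.
move=> t01; have [_ _ [_ c] _] := phi_classical.
by apply: continuous_row_measurable; exact: (continuous_on_space (c i)).
Qed.

(** * Backward induction over the rounds *)

Section verification.
Variables (T : nat) (alpha : adversary R K) (beta : forecaster R K).
Variable m0 : probability (state R K) R.
Let c : R := (Num.sqrt T%:R)^-1.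
Local Notation intg m f := (m.-integrable setT (EFin \o f)).
Hypothesis T_gt0 : (0 < T)%N.
Hypothesis beta_opt : forall n (h : n.-tuple (round R K)) i, (n < T)%N ->
  (beta h i)%:E = DmPhi phi (n%:R / T%:R) (rescale c (belief m0 h)) i.

Let TR_gt0 : 0 < T%:R :> R. Proof. by rewrite ltr0n. Qed.
Let c_gt0 : 0 < c. Proof. by rewrite invr_gt0 sqrtr_gt0. Qed.

Lemma time_in n : (n < T)%N -> 0 <= (n%:R / T%:R : R) < 1.
Proof. by move=> nT; rewrite divr_ge0//= ltr_pdivrMr// mul1r ltr_nat. Qed.

Lemma time_in1 n : (n <= T)%N -> 0 <= (n%:R / T%:R : R) <= 1.
Proof. by move=> nT; rewrite divr_ge0//= ler_pdivrMr// mul1r ler_nat. Qed.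

(** The equation defining the strategy identifies an extended integral with a real number, and this
    finiteness makes the gradient integrable under the belief. *)
Lemma beta_integral h i : (size h < T)%N ->
  let t := (size h)%:R / T%:R in
  intg (belief m0 h) (fun x => dx i phi t (c *: x)) /\
  (\int[belief m0 h]_x dx i phi t (c *: x))%R = beta h i.
Proof.
move=> hT t; have t01 : 0 <= t < 1 := time_in hT.
have md := dx_measurable i t01.
have := beta_opt (in_tuple h) i hT.
rewrite -/t /DmPhi /rescale integral_distribution_EFin//.
rewrite /= /dilate => E; split; last by rewrite /Rintegral -E.
by apply: integrable_fin_integral; [exact: measurable_comp_dilate|rewrite -E].
Qed.

(* The first-order term averages to zero: [sum_i beta_i = 1] and [beta] is the
   mean gradient under the belief. *)
Lemma first_order h : (size h < T)%N ->
  let t := (size h)%:R / T%:R in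
  let G := fun x : state R K => play_mean (beta h) (alpha h)
    (fun i j => \sum_l increment R i j ord0 l * dx l phi t (c *: x)) in
  intg (belief m0 h) G /\ (\int[belief m0 h]_x G x)%R = 0.
Proof.
move=> hT t G.
have Fi i j : intg (belief m0 h)
      (fun x => \sum_l increment R i j ord0 l * dx l phi t (c *: x)) /\
    (\int[belief m0 h]_x (\sum_l increment R i j ord0 l * dx l phi t (c *: x)) =
      \sum_l increment R i j ord0 l * beta h l)%R.
  have [I1 I2] := integrable_Rintegral_sum (index_enum 'I_K)
    (fun l (_ : increment R i j ord0 l != 0) => (beta_integral l hT).1).
  by split=> //; rewrite I2; apply: eq_bigr => l _; rewrite (beta_integral l hT).2.
have [I1 I2] := integrable_Rintegral_play_mean
  (fun i j (_ : beta h i * alpha h j != 0) => (Fi i j).1).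
split; first exact: I1.
rewrite [LHS]I2.
transitivity (play_mean (beta h) (alpha h)
    (fun i j => \sum_l (l \in j)%:R * beta h l + - (i \in j)%:R)).
  congr play_mean; apply/funext => i; apply/funext => j; rewrite (Fi i j).2.
  under eq_bigr do rewrite !mxE mulr1 mulrBl.
  by rewrite sumrB -mulr_sumr fdist_sum1 mulr1.
rewrite play_meanD [X in X + _](_ : _ = \sum_j alpha h j * \sum_l (l \in j)%:R * beta h l).
  rewrite [X in _ + X](_ : _ = - \sum_j alpha h j * \sum_l (l \in j)%:R * beta h l) ?subrr//.
  rewrite /play_mean -sumrN; under eq_bigr do rewrite mulr_sumr.
  rewrite exchange_big/=; apply: eq_bigr => j _; rewrite -mulrN -sumrN mulr_sumr.
  by apply: eq_bigr => i _; ring.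
by rewrite /play_mean -mulr_suml fdist_sum1 mul1r.
Qed.

Lemma integrable_maxcoord_shift (m : probability (state R K) R) (v : 'rV[R]_K) (r : R) :
  (forall l, `|v ord0 l| <= r) -> intg m (@maxcoord R K) ->
  intg m (fun x => maxcoord (x + v)).
Proof.
move=> vr mi.
have mm : measurable_fun setT (@maxcoord R K : state R K -> R).
  exact: measurable_maxcoord.
apply: (integrable_near (measurable_comp_translate v mm) mi) => x.
exact: maxcoord_lipschitz.
Qed.

(* In [phi_mean_step] every summand is bounded below by an integrable function
   since [maxcoord <= phi], so each one is also bounded above by one. *)
Lemma next_integrable h : (size h < T)%N ->
  let m := belief m0 h in
  let t := (size h)%:R / T%:R in let t' := (size h).+1%:R / T%:R in
  intg m (@maxcoord R K) -> intg m (fun x => phi t (c *: x)) ->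
  forall i j, beta h i * alpha h j != 0 ->
  intg m (fun x => phi t' (c *: (x + increment R i j))).
Proof.
move=> hT m t t' mi pi i j wij.
have [Gi _] := first_order hT.
have t'01 : 0 <= t' <= 1 := time_in1 hT.
set e := step_const * c / (T - size h)%:R.
have wpos i' j' : 0 <= beta h i' * alpha h j' by rewrite mulr_ge0 ?fdist_ge0.
have w0 : 0 < beta h i * alpha h j by rewrite lt_neqAle eq_sym wij wpos.
(* An increment lowers [maxcoord] by at most 1, whence [- c] after scaling. *)
pose L x := c * maxcoord x - c.
have Li : intg m L.
  exact: (integrable_subr (integrable_mulr c mi) (integrable_real_cst m c)).
pose P i' j' x := phi t' (c *: (x + increment R i' j')) - L x.
have P0 i' j' x : 0 <= P i' j' x.
  rewrite subr_ge0; apply: le_trans (maxcoord_le_phi _ t'01).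
  rewrite maxcoordZ// /L -[X in _ - X]mulr1 -mulrBr.
  apply: ler_wpM2l; first exact: ltW.
  have := maxcoord_lipschitz K_gt0 x (norm_increment R i' j').
  by rewrite ler_norml => /andP[h1 _]; lra.
pose B x := phi t (c *: x) + c * play_mean (beta h) (alpha h)
    (fun i j => \sum_l increment R i j ord0 l * dx l phi t (c *: x)) + e - L x.
have Bi : intg m B.
  apply: integrable_subr Li; apply: integrable_addr (integrable_real_cst m e).
  exact: integrable_addr pi (integrable_mulr c Gi).
have PB x : beta h i * alpha h j * P i j x <= B x.
  apply: (@le_trans _ _ (play_mean (beta h) (alpha h) (fun i' j' => P i' j' x))).
    rewrite play_mean_pair (bigD1 (i, j))//= lerDl; apply: sumr_ge0 => p _.
    by rewrite mulr_ge0.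
  have := phi_mean_step (beta h) (alpha h) (c *: x) hT erefl erefl.
  rewrite -/c -/t -/t' -/e /P /B => step.
  rewrite play_meanD play_mean_cst lerD2r; apply: le_trans step.
  by apply: le_play_mean => i' j'; rewrite scalerDr.
have mphi : measurable_fun setT (fun x : state R K => phi t' (c *: (x + increment R i j))).
  exact: (measurable_comp_translate _ (measurable_comp_dilate c (phi_measurable t'01))).
have Pi : intg m (P i j).
  apply: (@integrable_squeeze _ _ _ m _ (fun x => (beta h i * alpha h j)^-1 * B x)).
  - by apply: measurable_funB => //; exact: integrable_measurable Li.
  - exact: integrable_mulr Bi.
  - by move=> x; rewrite P0/= mulrC ler_pdivlMr// mulrC.
have := integrable_addr Pi Li.
by apply: eq_integrable => // x _ /=; congr EFin; rewrite /P subrK.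
Qed.

Lemma integrable_value (m : probability (state R K) R) k h :
  intg m (@maxcoord R K) -> intg m (value alpha beta k h).
Proof.
move=> mi; apply: (integrable_near (measurable_value alpha beta k h K_gt0) mi) => x.
exact: value_maxcoord.
Qed.

Lemma belief_rcons h r :
  belief m0 (rcons h r) = posterior (belief m0 h) r.1 r.2 :> probability _ _.
Proof. by rewrite /belief foldl_rcons. Qed.

(** Induction on the rounds to go, over all histories: a signal changes both history and belief, and
    the two integrability hypotheses are renewed under the posterior of each signal that can
    occur. *)
Lemma value_le_phi k h : (size h + k)%N = T ->
  let m := belief m0 h in let t := (size h)%:R / T%:R in
  intg m (@maxcoord R K) -> intg m (fun x => phi t (c *: x)) ->
  (\int[m]_x (c * value alpha beta k h x)
    <= \int[m]_x phi t (c *: x) + step_const * c * harmonic_sum R k)%R.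
Proof.
elim: k h => [|k IH] h sizeh m t mi pi.
  rewrite /harmonic_sum big_ord0 mulr0 addr0.
  have t1 : t = 1 by rewrite /t -sizeh addn0 divff// gt_eqF// -(addn0 (size h)) sizeh.
  apply: le_Rintegral => //; first exact: integrable_mulr mi.
  by move=> x _; rewrite /= -maxcoordZ// t1; exact: phi_term.
have hT : (size h < T)%N by rewrite -sizeh addnS ltnS leq_addr.
set b := beta h; set a := alpha h; pose t' : R := (size h).+1%:R / T%:R.
have t'01 : 0 <= t' <= 1 := time_in1 hT.
pose S := step_const * c * harmonic_sum R k.
pose v (y : signal K) (x : state R K) := c * value alpha beta k (rcons h (a, y)) x.
pose p (y : signal K) (x : state R K) := phi t' (c *: x).
have mv y : measurable_fun setT (v y).
  by apply: measurable_funM; [exact: measurable_cst|exact: measurable_value].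
have mp y : measurable_fun setT (p y).
  exact: (measurable_comp_dilate c (phi_measurable t'01)).
have shifti i j : intg m (fun x => maxcoord (x + increment R i j)).
  exact: integrable_maxcoord_shift (norm_increment R i j) mi.
have vi i j : b i * a j != 0 ->
    intg m (fun x => v (signal_of i j) (x + increment R i j)).
  move=> _; apply: integrable_mulr.
  have mv' := measurable_value alpha beta k (rcons h (a, signal_of i j)) K_gt0.
  apply: (integrable_near (measurable_comp_translate _ mv') (shifti i j)) => x.
  exact: value_maxcoord.
have pi' i j : b i * a j != 0 ->
    intg m (fun x => p (signal_of i j) (x + increment R i j)).
  exact: next_integrable.
have -> : (\int[m]_x (c * value alpha beta k.+1 h x))%R =
    play_mean b a (fun i j => \int[m]_x v (signal_of i j) (x + increment R i j))%R.
  rewrite -(integrable_Rintegral_play_mean vi).2.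
  by apply: eq_Rintegral => x _; rewrite /= -play_meanZ.
rewrite (play_mean_posterior mv vi).
(* The induction hypothesis is used under each posterior; a signal of probability 0 contributes 0 on
   both sides. *)
have post_le i (s : bool) : b i != 0 ->
    signal_prob a (i, s) * (\int[posterior m a (i, s)]_x v (i, s) x)%R
    <= signal_prob a (i, s) * ((\int[posterior m a (i, s)]_x p (i, s) x)%R + S).
  move=> bi; have [->|sp0] := eqVneq (signal_prob a (i, s)) 0; first by rewrite !mul0r.
  rewrite ler_wpM2l ?signal_prob_ge0//.
  have sgn (j : {set 'I_K}) : compatible (i, s) j -> signal_of i j = (i, s).
    by rewrite /compatible /signal_of => /eqP/= ->.
  have := IH (rcons h (a, (i, s))); rewrite size_rcons addSnnS => /(_ sizeh).
  rewrite belief_rcons /=; apply.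
  - apply: (integrable_posterior sp0); first exact: integrable_measurable mi.
    by move=> j js aj; have := shifti i j; rewrite increment_shift sgn.
  - apply: (integrable_posterior sp0); first exact: mp (i, s).
    move=> j js aj; have := pi' i j; rewrite mulf_neq0// => /(_ isT).
    by rewrite increment_shift sgn.
apply: (@le_trans _ _ (\sum_i b i * \sum_(s : bool) signal_prob a (i, s)
    * ((\int[posterior m a (i, s)]_x p (i, s) x)%R + S))).
  apply: ler_sum => i _; have [->|bi] := eqVneq (b i) 0; first by rewrite !mul0r.
  rewrite ler_wpM2l ?fdist_ge0//; apply: ler_sum => s _; exact: post_le.
(* Back to the prior: the signal probabilities add up to 1, so [S] comes out unchanged. *)
have -> : \sum_i b i * \sum_(s : bool) signal_prob a (i, s)
      * ((\int[posterior m a (i, s)]_x p (i, s) x)%R + S)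
    = play_mean b a (fun i j => \int[m]_x p (signal_of i j) (x + increment R i j))%R + S.
  rewrite (play_mean_posterior mp pi') -[X in _ = _ + X]mul1r -(fdist_sum1 b) mulr_suml.
  rewrite -big_split/=; apply: eq_bigr => i _; rewrite -mulrDr; congr (_ * _).
  by under eq_bigr do rewrite mulrDr; rewrite big_split/= -mulr_suml signal_prob_sum mul1r.
rewrite -(integrable_Rintegral_play_mean pi').2.
have [Gi G0] := first_order hT.
set G := (fun x => play_mean _ _ _) in Gi G0.
set e := step_const * c / (T - size h)%:R.
have cGi := integrable_mulr c Gi.
have ei := integrable_real_cst m e.
have -> : step_const * c * harmonic_sum R k.+1 = e + S.
  rewrite /harmonic_sum big_ord_recr/= -/(harmonic_sum R k) mulrDr addrC /e /S.
  by rewrite -[in RHS]sizeh addKn.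
rewrite addrA lerD2r.
(* The first-order term has integral 0, so adding it is free and reduces the claim to the pointwise
   bound of [phi_mean_step]. *)
have -> : (\int[m]_x phi t (c *: x) + e = \int[m]_x (phi t (c *: x) + c * G x + e))%R.
  rewrite (RintegralD measurableT (integrable_addr pi cGi) ei).
  rewrite (RintegralD measurableT pi cGi) (RintegralZl _ measurableT Gi) G0.
  rewrite mulr0 addr0 Rintegral_cst// [X in fine X](_ : _ = 1%E) ?mulr1//.
  exact: probability_setT.
apply: le_Rintegral => //.
- exact: (integrable_Rintegral_play_mean pi').1.
- exact: (integrable_addr (integrable_addr pi cGi) ei).
move=> x _; have := phi_mean_step b a (c *: x) hT erefl erefl; apply: le_trans.
by apply: le_play_mean => i j; rewrite /p scalerDr.
Qed.

Lemma regret_le_integrable :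
  intg m0 (@maxcoord R K) -> intg m0 (fun x => phi 0 (c *: x)) ->
  (regret T m0 alpha beta <= (c^-1 * (\int[m0]_x phi 0 (c *: x)
    + step_const * c * harmonic_sum R T))%R%:E)%E.
Proof.
move=> mi pi; have vi := integrable_value T [::] mi.
have := @value_le_phi T [::] (add0n T); rewrite /= mul0r => /(_ mi pi).
have regretE : regret T m0 alpha beta = (\int[m0]_x value alpha beta T [::] x)%R%:E.
  by rewrite regret_value /Rintegral fineK//; exact: (integrable_fin_num measurableT vi).
by rewrite RintegralZl// regretE lee_fin ler_pdivlMl.
Qed.

(** [value] differs from [maxcoord] by at most [T], so its negative part has infinite integral too,
    and adding [-oo] yields [-oo] whatever the positive part. *)
Lemma regret_Ny : (\int[m0]_x (EFin \o @maxcoord R K)^\- x = +oo)%E ->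
  regret T m0 alpha beta = -oo%E.
Proof.
move=> Noo; rewrite regret_value integralE.
set f := fun x : state R K => (value alpha beta T [::] x)%:E.
have mv : measurable_fun setT f.
  by apply/measurable_EFinP; exact: measurable_value.
suff -> : (\int[m0]_x f^\- x = +oo)%E by rewrite addeNy.
apply/eqP; rewrite eq_le leey/= leNgt; apply/negP => fin.
have : (\int[m0]_x (EFin \o @maxcoord R K)^\- x <= \int[m0]_x (f^\- x + T%:R%:E))%E.
  apply: ge0_le_integral => //.
  - apply: measurable_funeneg; apply/measurable_EFinP.
    exact: measurable_maxcoord.
  - by apply: emeasurable_funD; [exact: measurable_funeneg|exact: measurable_cst].
  move=> x _; rewrite !funenegE /f /= -!EFin_max -EFinD lee_fin.
  have := value_maxcoord alpha beta T [::] x K_gt0.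
  rewrite ler_norml => /andP[h1 h2]; rewrite ge_max; apply/andP; split.
    by rewrite -lerBlDr le_max; apply/orP; left; lra.
  by rewrite addr_ge0// le_max lexx orbT.
rewrite ge0_integralD//; [|exact: measurable_funeneg].
rewrite Noo integral_cst// [X in (_ * X)%E](_ : _ = 1%E); last exact: probability_setT.
by rewrite mule1 leye_eq => /eqP E; move: (lte_add_pinfty fin (ltry T%:R)); rewrite E ltxx.
Qed.

End verification.

(* An [ereal] integral whose positive and negative parts are both infinite is
   [-oo], and so is [+oo - +oo]: the inequality is then trivial. *)
Lemma scaled_regret_le T (beta : forecaster R K) (m0 : probability (state R K) R) :
  (0 < T)%N ->
  (forall n (h : n.-tuple (round R K)) i, (n < T)%N ->
    (beta h i)%:E =
    DmPhi phi (n%:R / T%:R) (rescale (Num.sqrt T%:R)^-1 (belief m0 h)) i) ->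
  (((Num.sqrt T%:R)^-1)%:E
     * ereal_sup [set regret T m0 alpha beta
                 | alpha in [set alpha : adversary R K | is_strategy alpha]]
   - Phi phi 0%R (rescale (Num.sqrt T%:R)^-1 m0)
   <= (step_const * (Num.sqrt T%:R)^-1 * harmonic_sum R T)%:E)%E.
Proof.
move=> T0 beta_opt; set c := (Num.sqrt T%:R)^-1; set S := ereal_sup _.
have c0 : 0 < c by rewrite invr_gt0 sqrtr_gt0 ltr0n.
have t01 : 0 <= (0 : R) <= 1 by rewrite lexx ler01.
have mphi := measurable_comp_dilate c (phi_measurable t01).
have mmax : measurable_fun setT (@maxcoord R K : state R K -> R).
  exact: measurable_maxcoord.
pose f x := phi 0 (c *: x).
have mE (g : state R K -> R) : measurable_fun setT g -> measurable_fun setT (EFin \o g).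
  by move=> mg; exact/measurable_EFinP.
have PhiE : Phi phi 0%R (rescale c m0) = (\int[m0]_x (f x)%:E)%E.
  by rewrite /Phi /rescale integral_distribution_EFin//; exact: phi_measurable.
(* This inequality carries finiteness both ways: of negative parts from [maxcoord] to [f], of
   positive parts from [f] to [maxcoord]. *)
have maxf x : c * maxcoord x <= f x by rewrite -maxcoordZ// maxcoord_le_phi.
rewrite PhiE.
have [Noo|Nfin] := eqVneq (\int[m0]_x (EFin \o @maxcoord R K)^\- x)%E +oo%E.
  suff -> : S = -oo%E by rewrite gt0_muleNy ?lte_fin// addNye leNye.
  apply/eqP; rewrite -leeNy_eq; apply: ge_ereal_sup => _ [alpha _ <-].
  by rewrite (regret_Ny T alpha beta Noo).
have {}Nfin : (\int[m0]_x (EFin \o @maxcoord R K)^\- x < +oo)%E by rewrite ltey.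
have fneg : (\int[m0]_x (EFin \o f)^\- x < +oo)%E.
  apply: (@le_lt_trans _ _ (\int[m0]_x (c%:E * (EFin \o @maxcoord R K)^\- x))%E).
    apply: ge0_le_integral => //.
    - by apply: measurable_funeneg; exact: mE.
    - by apply: measurable_funeM; apply: measurable_funeneg; exact: mE.
    move=> x _; rewrite !funenegE /= -!EFin_max -EFinM lee_fin.
    rewrite maxr_pMr ?(ltW c0)// mulr0 mulrN ge_max; apply/andP; split.
      by rewrite le_max lerN2 maxf.
    by rewrite le_max lexx orbT.
  rewrite ge0_integralZl//;
    [|by apply: measurable_funeneg; exact: mE|by rewrite lee_fin ltW].
  by rewrite lte_mul_pinfty// lee_fin ltW.
have [Poo|Pfin] := eqVneq (\int[m0]_x (EFin \o f)^\+ x)%E +oo%E.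
  rewrite [X in (_ - X)%E]integralE Poo.
  rewrite [X in (- X)%E](_ : _ = +oo%E) ?addeNy ?leNye//.
  by rewrite addye// gt_eqF// lteNr.
have {}Pfin : (\int[m0]_x (EFin \o f)^\+ x < +oo)%E by rewrite ltey.
have fi := integrable_funeposneg mphi Pfin fneg.
have maxi : m0.-integrable setT (EFin \o @maxcoord R K).
  apply: integrable_funeposneg => //.
  apply: (@le_lt_trans _ _ (\int[m0]_x ((c^-1)%:E * (EFin \o f)^\+ x))%E).
    apply: ge0_le_integral => //.
    - by apply: measurable_funepos; exact: mE.
    - by apply: measurable_funeM; apply: measurable_funepos; exact: mE.
    move=> x _; rewrite !funeposE /= -!EFin_max -EFinM lee_fin.
    rewrite maxr_pMr ?invr_ge0 ?(ltW c0)// mulr0 ge_max; apply/andP; split.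
      by rewrite le_max mulrC ler_pdivlMr// mulrC maxf.
    by rewrite le_max lexx orbT.
  rewrite ge0_integralZl//;
    [|by apply: measurable_funepos; exact: mE|by rewrite lee_fin invr_ge0 ltW].
  by rewrite lte_mul_pinfty// lee_fin invr_ge0 ltW.
have ffin := integrable_fin_num measurableT fi.
rewrite leeBlDr// -[X in (_ + X)%E]fineK// -EFinD addrC.
apply: (@le_trans _ _ (c%:E * (c^-1 * (\int[m0]_x f x
    + step_const * c * harmonic_sum R T))%R%:E)%E).
  rewrite lee_pmul2l// ?lte_fin//; apply: ge_ereal_sup => _ [alpha al <-].
  exact: regret_le_integrable.
by rewrite -EFinM mulrA mulfV ?mul1r// gt_eqF.
Qed.

End supersolution.

(** * Passage to the limit in the horizon *)

Theorem proposition4p1 (R : realType) (K : nat) (phi : R -> 'rV[R]_K -> R)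
    (C : R) (m0 : probability (state R K) R) (beta : nat -> forecaster R K) :
  (2 <= K)%N ->
  classical phi ->
  (forall t x, 0 <= t < 1 -> 0 >= dt phi t x + 2^-1 * generator phi t x) ->
  (forall x, phi 1 x >= maxcoord x) ->
  (forall t x (lambda : R), 0 <= t <= 1 ->
     phi t (x + lambda *: const_mx 1) = phi t x + lambda) ->
  0 < C ->
  (forall t x, 0 <= t < 1 -> higher_derivable phi t x) ->
  (forall t x, 0 <= t < 1 ->
     `|dt (dt phi) t x| <= C / (1 - t) `^ (3 / 2)) ->
  (forall t x, 0 <= t < 1 ->
     norm_dxxx phi t x + norm_dtx phi t x <= C / (1 - t)) ->
  (forall T, is_strategy (beta T)) ->
  (forall (T n : nat) (h : n.-tuple (round R K)) (i : 'I_K), (n < T)%N ->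
     (beta T h i)%:E =
     DmPhi phi (n%:R / T%:R) (rescale (Num.sqrt T%:R)^-1 (belief m0 h)) i) ->
  (limn_esup (fun T : nat =>
     ((Num.sqrt T%:R)^-1)%:E
       * ereal_sup [set regret T m0 alpha (beta T)
                   | alpha in [set alpha : adversary R K | is_strategy alpha]]
     - Phi phi 0%R (rescale (Num.sqrt T%:R)^-1 m0)) <= 0)%E.
Proof.
move=> K2 phi_cl phi_pde phi_term _ C_gt0 phi_hd phi_tt phi_xxx _ beta_opt.
have K_gt0 : (0 < K)%N by rewrite (leq_trans _ K2).
have A0 : 0 <= step_const K C.
  by apply: mulr_ge0; [exact: ltW|rewrite !addr_ge0// divr_ge0// exprn_ge0].
apply/lee_addgt0Pr => e e0; rewrite add0e.
set u := fun T : nat => _.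
have b0 : 0 <= 4 * step_const K C / e.
  by apply: divr_ge0; [exact: mulr_ge0|exact: ltW].
(* With [harmonic_sum_le] the error is at most [4 * step_const K C / T ^ (1/4)], hence at most [e]
   once [M <= T]. *)
pose M := (4 * step_const K C / e) ^+ 4.
(* The successor gives [M <= N] and also [0 < N], which leaves out the horizon [T = 0]. *)
pose N := (Num.truncn M).+1.
apply: (@le_trans _ _ (ereal_sup (u @` [set T | (N <= T)%N]))).
  by apply: ereal_inf_lbound; exists [set T | (N <= T)%N] => //; exists N.
apply: ge_ereal_sup => _ [T /= NT <-].
have T0 : (0 < T)%N by rewrite (leq_trans _ NT).
apply: le_trans (scaled_regret_le K_gt0 phi_cl phi_pde phi_term C_gt0 phi_hd
  phi_tt phi_xxx T0 (beta_opt T)) _.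
rewrite lee_fin.
have MT : M <= T%:R.
  by apply: ltW; apply: lt_le_trans (truncnS_gt M) _; rewrite ler_nat.
set r := Num.sqrt (Num.sqrt (T%:R : R)).
have r0 : 0 < r by rewrite !sqrtr_gt0 ltr0n.
have Tr : Num.sqrt (T%:R : R) = r ^+ 2 by rewrite sqr_sqrtr// sqrtr_ge0.
have rM : 4 * step_const K C / e <= r.
  have := @ler_pXn2r _ 4 isT (4 * step_const K C / e) r.
  rewrite !nnegrE => <- //; last exact: ltW.
  by rewrite (exprM r 2 2) -Tr sqr_sqrtr.
apply: (@le_trans _ _ (step_const K C * (r ^+ 2)^-1 * (4 * r))).
  rewrite Tr; apply: ler_wpM2l; last exact: harmonic_sum_le.
  by rewrite mulr_ge0// invr_ge0 sqr_ge0.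
rewrite (_ : _ * _ = 4 * step_const K C / r); last by field; rewrite gt_eqF.
by rewrite ler_pdivrMr// [e * r]mulrC -ler_pdivrMr.
Qed.
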